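(* Let $G$ be a finitely generated group. Then $G$ has a faithful action on some locally finite tree without a global fixed point if and only if $G$ can be expressed as the fundamental group of a non-trivial finite graph of groups in which all vertex groups are residually finite (but not necessarily finitely generated) and all edge groups have finite index in the corresponding vertex groups.
   Context: Trees are simplicial trees, regarded as metric spaces with the path metric. An action of a group on a tree is an action by simplicial automorphisms (it need not be faithful, and edge inversions may be allowed, since one can pass to the barycentric subdivision). A tree is locally finite if every vertex has finite degree. A global fixed point is a point of the tree fixed by every element of the group. A finite graph of groups has a finite connected underlying graph; the decomposition of $G$ is called non-trivial if the action of $G$ on the associated Bass-Serre tree has no global fixed point (equivalently, no vertex group is all of $G$). *)

(* Defs.v *)
From HB Require Import structures.
From mathcomp Require Import all_boot all_order all_fingroup all_algebra.
From mathcomp Require Import all_classical.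
From Stdlib Require Import Rdefinitions.
From mathcomp Require Import Rstruct.

Set Implicit Arguments.
Unset Strict Implicit.
Unset Printing Implicit Defensive.

Local Open Scope classical_set_scope.
Local Open Scope quotient_scope.
Local Open Scope group_scope.

(** * Groups *)

Section GroupProperties.
Variable G : groupType.

Definition is_subgroup (H : set G) : Prop :=
  [/\ H 1, forall x y, H x -> H y -> H (x * y) & forall x, H x -> H x^-1].

Definition finitely_generated : Prop :=
  exists s : seq G, smallest is_subgroup [set` s] = setT.

Definition residually_finite : Prop :=
  forall g : G, g <> 1 ->
    exists (F : finGroupType) (f : {multiplicative G -> F}), f g <> 1.

Definition left_coset (g : G) (H : set G) : set G := [set g * h | h in H].

Definition finite_index (H : set G) : Prop :=
  finite_set [set left_coset g H | g in [set: G]].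

End GroupProperties.

(** * Simplicial trees *)

Section Trees.
Variables (V : choiceType) (adj : rel V).

(* A cycle is listed without repetition; the lists [x; y] with adj x y satisfy
   [ucycle] but only traverse one edge back and forth. *)
Definition is_tree : Prop :=
  [/\ inhabited V, symmetric adj, irreflexive adj,
      forall x y, exists2 s, path adj x s & last x s = y
    & forall c, ucycle adj c -> (size c <= 2)%N].

Definition locally_finite : Prop :=
  forall x, finite_set [set y | adj x y].

Local Open Scope ring_scope.

(* Points of the geometric realization, in barycentric coordinates: the point
   at distance t from x on the segment [x, y] has weight 1 - t at x and t at y. *)
Definition is_point (p : V -> R) : Prop :=
  exists (x y : V) (t : R),
    [/\ x = y \/ adj x y, 0 <= t <= 1
      & forall z, p z = (1 - t) * (z == x)%:R + t * (z == y)%:R].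

End Trees.

Section Actions.
Variables (G : groupType) (V : choiceType) (adj : rel V) (act : G -> V -> V).

Definition is_simplicial_action : Prop :=
  [/\ forall x, act 1 x = x,
      forall g h x, act (g * h) x = act g (act h x)
    & forall g x y, adj (act g x) (act g y) = adj x y].

Definition faithful_action : Prop :=
  forall g, (forall x, act g x = x) -> g = 1.

Definition has_global_fixed_point : Prop :=
  exists2 p : V -> R, is_point adj p & forall g z, p (act g^-1 z) = p z.

End Actions.

(** * Groups given by generators and relations *)

Section Presentation.
Variable X : choiceType.

(* (x, true) stands for the generator x, and (x, false) for its inverse. *)
Definition word : Type := seq (X * bool).

Definition word_inv (w : word) : word := rev [seq (a.1, ~~ a.2) | a <- w].

Variable rels : word -> word -> Prop.

Inductive word_congr : word -> word -> Prop :=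
| word_congr_rel u v of rels u v : word_congr u v
| word_congr_free x b : word_congr [:: (x, b); (x, ~~ b)] [::]
| word_congr_refl u : word_congr u u
| word_congr_sym u v of word_congr u v : word_congr v u
| word_congr_trans u v w of word_congr u v & word_congr v w : word_congr u w
| word_congr_cat u u' v v' of word_congr u u' & word_congr v v' :
    word_congr (u ++ v) (u' ++ v').

Definition word_eqv : rel word := fun u v => `[< word_congr u v >].

Lemma word_eqv_refl : reflexive word_eqv.
Proof. by move=> u; apply/asboolP/word_congr_refl. Qed.

Lemma word_eqv_sym : symmetric word_eqv.
Proof.
by move=> u v; apply/asboolP/asboolP => uv; apply: word_congr_sym.
Qed.

Lemma word_eqv_trans : transitive word_eqv.
Proof.
move=> v u w /asboolP uv /asboolP vw; apply/asboolP.
exact: word_congr_trans uv vw.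
Qed.

Canonical word_equiv :=
  EquivRel word_eqv word_eqv_refl word_eqv_sym word_eqv_trans.

Definition presented_group : Type := {eq_quot word_eqv}.

Lemma word_piP (u v : word) :
  \pi_presented_group u = \pi_presented_group v <-> word_congr u v.
Proof.
by split=> [/eqmodP/asboolP | uv] //; apply/eqmodP/asboolP.
Qed.

Lemma word_inv_cat u v : word_inv (u ++ v) = word_inv v ++ word_inv u.
Proof. by rewrite /word_inv map_cat rev_cat. Qed.

Lemma word_invK : involutive word_inv.
Proof.
move=> u; rewrite /word_inv map_rev revK -map_comp -[RHS]map_id.
by apply: eq_map => -[x b] /=; rewrite negbK.
Qed.

Lemma word_congr_mulV u : word_congr (u ++ word_inv u) [::].
Proof.
elim: u => [|[x b] u IHu]; first exact: word_congr_refl.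
rewrite -cat1s word_inv_cat -catA.
rewrite [X in _ ++ X](catA u (word_inv u) [:: (x, ~~ b)]).
apply: word_congr_trans (word_congr_free x b).
apply: word_congr_cat (word_congr_refl [:: (x, b)]) _.
exact: word_congr_cat IHu (word_congr_refl [:: (x, ~~ b)]).
Qed.

Lemma word_congr_Vmul u : word_congr (word_inv u ++ u) [::].
Proof. by rewrite -{2}[u]word_invK; apply: word_congr_mulV. Qed.

Lemma word_congr_inv u v : word_congr u v ->
  word_congr (word_inv u) (word_inv v).
Proof.
move=> uv; apply: (@word_congr_trans _ (word_inv u ++ (v ++ word_inv v))).
  rewrite -{1}[word_inv u]cats0.
  apply: word_congr_cat; first exact: word_congr_refl.
  exact/word_congr_sym/word_congr_mulV.
rewrite catA -[X in word_congr _ X]cat0s.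
apply: word_congr_cat; last exact: word_congr_refl.
apply: word_congr_trans (word_congr_Vmul u).
apply: word_congr_cat; first exact: word_congr_refl.
exact: word_congr_sym.
Qed.

Definition presented_one : presented_group :=
  \pi_presented_group ([::] : word).
Definition presented_mul (a b : presented_group) : presented_group :=
  \pi_presented_group (generic_quotient.repr a ++ generic_quotient.repr b).
Definition presented_inv (a : presented_group) : presented_group :=
  \pi_presented_group (word_inv (generic_quotient.repr a)).

Lemma presented_reprK (u : word) :
  word_congr (generic_quotient.repr (\pi_presented_group u)) u.
Proof. by apply/word_piP; rewrite reprK. Qed.

Lemma presented_mulE (u v : word) :
  presented_mul (\pi u) (\pi v) = \pi_presented_group (u ++ v).
Proof. by apply/word_piP; apply: word_congr_cat; apply: presented_reprK. Qed.

Lemma presented_invE (u : word) :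
  presented_inv (\pi u) = \pi_presented_group (word_inv u).
Proof. by apply/word_piP; apply: word_congr_inv; apply: presented_reprK. Qed.

Lemma presented_mulA : associative presented_mul.
Proof.
move=> a b c; rewrite -[a]reprK -[b]reprK -[c]reprK.
by rewrite !presented_mulE catA.
Qed.

Lemma presented_mul1 : left_id presented_one presented_mul.
Proof. by move=> a; rewrite -[a]reprK presented_mulE. Qed.

Lemma presented_mulr1 : right_id presented_one presented_mul.
Proof. by move=> a; rewrite -[a]reprK presented_mulE cats0. Qed.

Lemma presented_mulV :
  left_inverse presented_one presented_inv presented_mul.
Proof.
move=> a; rewrite -[a]reprK presented_invE presented_mulE.
by apply/word_piP; apply: word_congr_Vmul.
Qed.

Lemma presented_mulrV :
  right_inverse presented_one presented_inv presented_mul.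
Proof.
move=> a; rewrite -[a]reprK presented_invE presented_mulE.
by apply/word_piP; apply: word_congr_mulV.
Qed.

HB.instance Definition _ := Choice.on presented_group.
HB.instance Definition _ := isGroup.Build presented_group
  presented_mulA presented_mul1 presented_mulr1 presented_mulV presented_mulrV.

Definition presented_gen (x : X) : presented_group :=
  \pi_presented_group ([:: (x, true)] : word).

End Presentation.

(** * Graphs of groups *)

(* The underlying graph may have loops and multiple edges.  Each geometric
   edge is listed once, with an arbitrary orientation, and carries two
   monomorphisms of its group into the groups of its end points. *)
Record finite_graph_of_groups := GraphOfGroups {
  gg_vertex : finType;
  gg_edge : finType;
  gg_src : gg_edge -> gg_vertex;
  gg_tgt : gg_edge -> gg_vertex;
  vertex_group : gg_vertex -> groupType;
  edge_group : gg_edge -> groupType;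
  src_mono : forall e, {multiplicative edge_group e -> vertex_group (gg_src e)};
  tgt_mono : forall e, {multiplicative edge_group e -> vertex_group (gg_tgt e)};
  src_mono_inj : forall e, injective (src_mono e);
  tgt_mono_inj : forall e, injective (tgt_mono e);
  gg_nonempty : (0 < #|gg_vertex|)%N;
  gg_connected : forall u v : gg_vertex,
    connect [rel x y | [exists e, ((gg_src e == x) && (gg_tgt e == y))
                               || ((gg_src e == y) && (gg_tgt e == x))]] u v
}.

Section FundamentalGroup.
Variables (A : finite_graph_of_groups) (T : {set gg_edge A}).

Definition edges_adj : rel (gg_vertex A) :=
  [rel x y | [exists e in T, ((gg_src e == x) && (gg_tgt e == y))
                          || ((gg_src e == y) && (gg_tgt e == x))]].

(* The second clause forbids multiple edges, which [edges_adj] cannot see. *)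
Definition spanning_tree : Prop :=
  is_tree edges_adj /\
  {in T &, injective (fun e => [set gg_src e; gg_tgt e]%SET)}.

Definition fg_gen : choiceType := ({v : gg_vertex A & vertex_group v} + gg_edge A)%type.

Definition vertex_letter v (g : vertex_group v) : fg_gen * bool :=
  (inl (Tagged (@vertex_group A) g), true).
Definition edge_letter (e : gg_edge A) (b : bool) : fg_gen * bool := (inr e, b).

Inductive fg_rels : word fg_gen -> word fg_gen -> Prop :=
| fg_rel_vertex v (g h : vertex_group v) :
    fg_rels [:: vertex_letter g; vertex_letter h] [:: vertex_letter (g * h)]
| fg_rel_edge e (c : edge_group e) :
    fg_rels [:: edge_letter e false; vertex_letter (src_mono e c);
                edge_letter e true]
            [:: vertex_letter (tgt_mono e c)]
| fg_rel_tree e of e \in T : fg_rels [:: edge_letter e true] [::].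

(* The fundamental group of A relative to the maximal tree T; its isomorphism
   type does not depend on T. *)
Definition fundamental_group : groupType := presented_group fg_rels.

Definition vertex_elt v (g : vertex_group v) : fundamental_group :=
  presented_gen fg_rels (inl (Tagged (@vertex_group A) g)).
Definition edge_elt (e : gg_edge A) : fundamental_group :=
  presented_gen fg_rels (inr e).

(* The Bass-Serre tree: the vertices are the left cosets of the images of the
   vertex groups, and each left coset g * src_mono e (edge_group e) is an edge
   joining the cosets of g and g * e.  Since this graph is a tree, it is
   determined by its adjacency relation. *)
Definition is_bs_vertex (x : gg_vertex A * set fundamental_group) : bool :=
  `[< exists g, x.2 = left_coset g (range (@vertex_elt x.1)) >].

Definition bs_vertex : choiceType := {x | is_bs_vertex x}.

Lemma bs_coset_subproof v g :
  is_bs_vertex (v, left_coset g (range (@vertex_elt v))).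
Proof. by apply/asboolP; exists g. Qed.

Definition bs_coset v (g : fundamental_group) : bs_vertex :=
  exist (fun x => is_bs_vertex x)
    (v, left_coset g (range (@vertex_elt v))) (bs_coset_subproof v g).

Definition bs_adj : rel bs_vertex := fun x y =>
  `[< exists e g,
        let s := bs_coset (gg_src e) g in
        let t := bs_coset (gg_tgt e) (g * edge_elt e) in
        (x = s /\ y = t) \/ (x = t /\ y = s) >].

Lemma left_cosetM (G : groupType) (g h : G) (H : set G) :
  left_coset g (left_coset h H) = left_coset (g * h) H.
Proof.
rewrite /left_coset image_comp; apply: eq_imagel => x _ /=.
by rewrite mulgA.
Qed.

Lemma bs_act_subproof g (x : bs_vertex) :
  is_bs_vertex ((val x).1, left_coset g (val x).2).
Proof.
case: x => -[v C] /= /asboolP [h /= ->]; apply/asboolP; exists (g * h).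
exact: left_cosetM.
Qed.

Definition bs_act (g : fundamental_group) (x : bs_vertex) : bs_vertex :=
  exist (fun y => is_bs_vertex y)
    ((val x).1, left_coset g (val x).2) (bs_act_subproof g x).

End FundamentalGroup.

(* Main.v *)
Require Import Defs.
From HB Require Import structures.
From mathcomp Require Import all_boot all_order all_fingroup all_algebra.
From mathcomp Require Import all_classical.
From mathcomp Require Import Rstruct.

(* Let [G] act faithfully on a locally finite tree, bipartite after barycentric
   subdivision, so without inversions. Since [G] is finitely generated, the
   translates of a large ball form a connected subgraph with finitely many
   orbits. A maximal subtree meeting each of these orbits at most once meets all
   of them, and its stabilizers give a finite graph of groups. The map from the
   Bass-Serre tree back to the tree is locally injective, hence injective, so
   that the fundamental group is [G]. A vertex stabilizer has finite orbits,
   hence is residually finite.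

   Conversely, no normal forms are needed. The Bass-Serre graph has no cycles
   because the boundary map of its chains modulo 2 is split by an affine action
   of the fundamental group. Vertex groups embed because the fundamental group
   acts on a set on which each of them acts freely. The tree is locally finite,
   but the action may have a kernel; it lies in the stabilizer of a vertex [x0],
   which has a chain of subgroups of finite index with trivial intersection.
   Hanging the rooted tree of cosets of this chain on the orbit of [x0] makes the
   action faithful. *)

Set Implicit Arguments.
Unset Strict Implicit.
Unset Printing Implicit Defensive.

Local Open Scope classical_set_scope.
Local Open Scope quotient_scope.
Local Open Scope group_scope.

(** * Trees and rooted height functions *)

(** The fundamental group is given by a presentation, so the handle on it is to map it to other
    groups. Two such maps do the work of normal forms: one into permutations of [free_set], one into
    affine permutations of chains. In both, the edge relations prescribe intertwiners edge by edge,
    while the letters of the spanning tree have to act trivially; [tree_section] reconciles the two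
    by transport along the tree.

    The other trees of the proof (subdivision, blow-up, spanning tree of the quotient) carry an
    explicit height for which each vertex has at most one neighbour not above it, as
    [rooted_height_tree] requires.

    In the quotient, the letters of the spanning tree must map to 1 in [G]. This is why edges with
    both ends in the transversal represent themselves and why [tr] is trivial on it.

    In the converse, finite generation enters as countability: an enumeration of [G] turns residual
    finiteness into a descending sequence of subgroups. *)

Section Reach.
Variables (V : choiceType).
Implicit Types (adj : rel V) (x y z : V).

Definition reach adj x y : Prop := exists2 s, path adj x s & last x s = y.

Lemma reach_refl adj x : reach adj x x.
Proof. by exists [::]. Qed.

Lemma reach_trans adj x y z : reach adj x y -> reach adj y z -> reach adj x z.
Proof.
move=> [s ps <-] [t pt <-]; exists (s ++ t); first by rewrite cat_path ps.
by rewrite last_cat.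
Qed.

Lemma reach_edge adj x y : adj x y -> reach adj x y.
Proof. by move=> xy; exists [:: y]; rewrite //= xy. Qed.

Lemma reach_sym adj x y : symmetric adj -> reach adj x y -> reach adj y x.
Proof.
move=> sadj [s ps <-]; exists (rev (belast x s)); last first.
  by case: s {ps} => //= y0 s; rewrite rev_cons last_rcons.
rewrite rev_path; apply: sub_path ps => a b /=; by rewrite sadj.
Qed.

Lemma reach_ind_set adj (P : set V) x y :
  (forall a b, P a -> adj a b -> P b) -> P x -> reach adj x y -> P y.
Proof.
move=> Padj Px [s ps <-]; elim: s x Px ps => //= b s IHs x Px /andP[xb ps].
exact: IHs (Padj _ _ Px xb) ps.
Qed.

Lemma reach_sub adj adj' x y :
  subrel adj adj' -> reach adj x y -> reach adj' x y.
Proof. by move=> sub [s ps <-]; exists s => //; apply: sub_path ps. Qed.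

Definition del_edge adj x y : rel V :=
  fun a b => adj a b && ~~ (((a == x) && (b == y)) || ((a == y) && (b == x))).

(* The neighbours of [x] that are not strictly farther from the root than [x]
   reduce to its parent. *)
Definition rooted_height adj (r : V) (h : V -> nat) : Prop :=
  [/\ symmetric adj, irreflexive adj,
      forall x, x <> r -> exists2 y, adj x y & h y < h x
    & forall x y y', adj x y -> adj x y' -> h y <= h x -> h y' <= h x -> y = y'].

Lemma is_tree_bridge adj x y : is_tree adj -> adj x y ->
  ~ reach (del_edge adj x y) y x.
Proof.
move=> [_ sadj iadj _ noc] xy [s ps]; case/shortenP: ps => p pp up _ lastp.
have subd : subrel (del_edge adj x y) adj by move=> a b /andP[].
have : ucycle adj (y :: p).
  by rewrite /ucycle up andbT /= rcons_path (sub_path subd pp) lastp.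
(* At most two vertices remain: either [y = x], a loop, or the path is the deleted edge itself. *)
move=> /noc; case: p pp up lastp => [|z [|//]] /=.
  by move=> _ _ yx; rewrite yx iadj in xy.
by rewrite /del_edge => + _ zx; rewrite zx !eqxx /= orbT andbF.
Qed.

(** The height is the distance to [r]. *)
Lemma is_tree_height adj r : is_tree adj ->
  exists h : V -> nat, [/\ rooted_height adj r h, h r = 0
    & forall x y, adj x y -> h x = (h y).+1 \/ h y = (h x).+1].
Proof.
move=> tadj; have [_ sadj iadj conn _] := tadj.
pose P x n := `[< exists s, [/\ path adj r s, last r s = x & size s = n] >].
have exP x : exists n, P x n.
  by have [s ps ls] := conn r x; exists (size s); apply/asboolP; exists s.
pose h x := ex_minn (exP x).
have hP x s : path adj r s -> last r s = x -> h x <= size s.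
  move=> ps ls; rewrite /h; case: ex_minnP => m _; apply.
  by apply/asboolP; exists s.
have hex x : exists s, [/\ path adj r s, last r s = x & size s = h x].
  by rewrite /h; case: ex_minnP => m /asboolP.
have hr : h r = 0 by apply/eqP; rewrite -leqn0; apply: (@hP r [::]).
have h_adj x y : adj x y -> h y <= (h x).+1.
  move=> xy; have [s [ps ls <-]] := hex x.
  by rewrite -(size_rcons s y); apply: hP; rewrite ?last_rcons // rcons_path ps ls.
have lower x : x <> r -> exists2 y, adj x y & h x = (h y).+1.
  move=> xr; have [s [ps ls hs]] := hex x.
  case/lastP: s ps ls hs => [|s z]; first by move=> _ /=/esym.
  rewrite rcons_path last_rcons size_rcons => /andP[ps ladj] zx hs.
  exists (last r s); first by rewrite sadj -zx.
  apply/eqP; rewrite eqn_leq h_adj ?zx; last by rewrite -zx.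
  by rewrite -hs ltnS; apply: hP.
(* Heights decrease on the way to [r], so a descent that starts no higher than [x], and away from
   [x], never meets [x]. *)
have toroot x : forall n y, h y = n -> n <= h x -> y <> x ->
    reach (fun a b => [&& adj a b, a != x & b != x]) y r.
  elim=> [|n IHn] y hy nx yx.
    have [->|/eqP yr] := eqVneq y r; first exact: reach_refl.
    by have [z _] := lower _ yr; rewrite hy.
  have [->|/eqP yr] := eqVneq y r; first exact: reach_refl.
  have [z yz] := lower _ yr; rewrite hy => -[hz].
  have zx : z <> x by move=> e; rewrite hz e ltnn in nx.
  apply: reach_trans (IHn z (esym hz) (ltnW nx) zx).
  apply: reach_edge; apply/and3P; split=> //; exact/eqP.
(* Two distinct such neighbours are joined through [r] away from [x]; followed by the edge from [y']
   to [x], this bypasses the edge between [x] and [y]. *)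
have uniq_lower x y y' :
    adj x y -> adj x y' -> h y <= h x -> h y' <= h x -> y = y'.
  move=> xy xy' hy hy'; apply: contrapT => yy'.
  apply: (is_tree_bridge tadj xy).
  have yx : y <> x by move=> e; rewrite e iadj in xy.
  have y'x : y' <> x by move=> e; rewrite e iadj in xy'.
  pose q := (fun a b => [&& adj a b, a != x & b != x]).
  have sq : symmetric q by move=> a b; rewrite /q sadj [(b != x) && _]andbC.
  have subq : subrel q (del_edge adj x y).
    move=> a b /and3P[ab /negbTE ax /negbTE bx].
    by rewrite /del_edge ab ax bx !andbF.
  have r1 := reach_sub subq (toroot x _ _ erefl hy yx).
  have r2 := reach_sub subq (reach_sym sq (toroot x _ _ erefl hy' y'x)).
  apply: reach_trans r1 (reach_trans r2 (reach_edge _)).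
  rewrite /del_edge sadj xy' /= (introF eqP y'x) /=.
  by rewrite (introF eqP (fun e => yy' (esym e))).
exists h; split=> //.
  split=> // x /lower[y xy hxy]; exists y => //.
  by rewrite hxy.
move=> x y xy.
wlog hyx : x y xy / h y <= h x.
  move=> W; case/orP: (leq_total (h y) (h x)) => hyx; first exact: W.
  by rewrite or_comm; apply: W => //; rewrite sadj.
have [xr|/eqP xr] := eqVneq x r.
  have hy : h y <= 0 by rewrite -hr -xr.
  have [yr|/eqP yr] := eqVneq y r; first by rewrite xr yr iadj in xy.
  by have [z _ hz] := lower _ yr; rewrite hz in hy.
have [z xz hz] := lower _ xr; left.
by rewrite (uniq_lower x y z) // hz.
Qed.

Lemma rooted_height_reach adj r h x : rooted_height adj r h -> reach adj x r.
Proof.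
move=> [sadj iadj lower _].
have [n] := ubnP (h x); elim: n x => // n IHn x hx.
have [->|/eqP xr] := eqVneq x r; first exact: reach_refl.
have [y xy yx] := lower _ xr.
apply: reach_trans (reach_edge xy) (IHn _ _).
by apply: leq_trans yx _; rewrite -ltnS.
Qed.

(** On a cycle, a vertex of maximal height would have two distinct neighbours not above it. *)
Lemma rooted_height_tree adj r h : rooted_height adj r h -> is_tree adj.
Proof.
move=> rh; have [sadj iadj lower uniqlow] := rh; split=> //.
- move=> x y; apply: (@reach_trans _ _ r _ (rooted_height_reach x rh)).
  exact/(reach_sym sadj)/(rooted_height_reach y rh).
move=> c /andP[cyc uc]; rewrite leqNgt; apply/negP => c3.
have [m /[dup] mc /rot_to[i c' rotc] maxm] :
    exists2 m, m \in c & forall x, x \in c -> h x <= h m.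
  case: c {cyc uc} c3 => // a c _; elim: c a => [|b c IHc] a.
    by exists a; rewrite ?inE // => x; rewrite inE => /eqP ->.
  have [m mc maxm] := IHc b; case: (leqP (h a) (h m)) => am.
    exists m; first by rewrite inE mc orbT.
    by move=> x; rewrite inE => /orP[/eqP -> //|/maxm].
  exists a; first by rewrite inE eqxx.
  move=> x; rewrite inE => /orP[/eqP -> //|/maxm xm].
  exact: leq_trans xm (ltnW am).
have inc x : x \in m :: c' -> h x <= h m.
  by rewrite -rotc mem_rot; apply: maxm.
move: cyc uc c3; rewrite -(rot_cycle i) -(rot_uniq i) -(size_rot i) rotc.
case: c' inc {rotc} => // a c'; case/lastP: c' => // c' b inc.
rewrite /= rcons_path last_rcons.
move=> /and3P[ma _ bm] /and3P[_ anc _] _.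
suff ab : a = b by rewrite ab mem_rcons inE eqxx in anc.
apply: (uniqlow m) => //; first by rewrite sadj.
  by apply: inc; rewrite !inE eqxx orbT.
by apply: inc; rewrite !inE mem_rcons inE eqxx !orbT.
Qed.

(** Criterion for the Bass-Serre graph, where no height is at hand: a cycle minus one of its edges
    reconnects the ends of that edge. *)
Lemma bridges_tree adj : inhabited V -> symmetric adj -> irreflexive adj ->
  (forall x y, reach adj x y) ->
  (forall x y, adj x y -> ~ reach (del_edge adj x y) y x) -> is_tree adj.
Proof.
move=> inh sadj iadj conn br; split=> // -[|x [|y [|z s]]] //.
rewrite /ucycle /= rcons_path !inE => /andP[/and4P[xy yz zs sx]].
rewrite !negb_or => /and3P[/and3P[xny xnz xs] /andP[ynz ys] _].
case: (br _ _ xy); exists (z :: rcons s x); last by rewrite /= last_rcons.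
have zx : (z == x) = false by rewrite eq_sym (negbTE xnz).
have yx : (y == x) = false by rewrite eq_sym (negbTE xny).
rewrite /= {1}/del_edge yz zx yx andbF /=.
apply: (@sub_in_path _ [pred a | a != y] adj); last by rewrite rcons_path zs.
  move=> a b; rewrite !inE => /negbTE ay /negbTE b_y ab.
  by rewrite /del_edge ab ay b_y andbF.
rewrite /= all_rcons inE eq_sym ynz /= xny /=; apply/allP => a a_s.
by apply: contraNneq ys => <-.
Qed.

End Reach.

(** * Fixed points as fixed vertices or invariant edges *)

Section FixedPair.
Variables (G : groupType) (V : choiceType) (adj : rel V) (act : G -> V -> V).
Hypothesis act1 : forall x, act 1%g x = x.
Hypothesis actM : forall g h x, act (g * h)%g x = act g (act h x).

(** The case [x = y] is a fixed vertex; otherwise an edge is kept as a set, possibly flipped, and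
    its midpoint is fixed. *)
Definition fixed_pair : Prop := exists x y, (x = y \/ adj x y) /\
  forall g, (act g x = x /\ act g y = y) \/ (act g x = y /\ act g y = x).

Lemma gactK g : cancel (act g) (act g^-1).
Proof. by move=> x; rewrite -actM mulVg act1. Qed.

Lemma gactKV g : cancel (act g^-1) (act g).
Proof. by move=> x; rewrite -actM mulgV act1. Qed.

Lemma gact_inj g : injective (act g).
Proof. exact: can_inj (gactK g). Qed.

Lemma gactV_eq g x z : (act g^-1 z == x) = (z == act g x).
Proof. by apply/eqP/eqP => [<-|->]; rewrite ?gactK ?gactKV. Qed.

Lemma global_fixed_pairP : has_global_fixed_point adj act <-> fixed_pair.
Proof.
split=> [[p [x [y [t [xy /andP[t0 t1] pE]]]] pinv]|[x [y [xy inv]]]].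
  have single u : (forall z, p z = (z == u)%:R%R) -> fixed_pair.
    move=> pu; exists u, u; split; first by left.
    move=> g; left; suff -> : act g u = u by [].
    apply/eqP; have := pinv g (act g u); rewrite !pu gactK eqxx.
    case: eqP => // _ /eqP; by rewrite GRing.oner_eq0.
  case: xy => [xy|xy].
    apply: (single x) => z; rewrite pE -xy -GRing.mulrDl.
    by rewrite GRing.subrK GRing.mul1r.
  have [t_0|t0'] := eqVneq t 0%R.
    apply: (single x) => z; rewrite pE t_0 GRing.subr0 GRing.mul1r.
    by rewrite GRing.mul0r GRing.addr0.
  have [t_1|t1'] := eqVneq t 1%R.
    apply: (single y) => z; rewrite pE t_1 GRing.subrr GRing.mul1r.
    by rewrite GRing.mul0r GRing.add0r.
  have tp : (0 < t)%R by rewrite Order.POrderTheory.lt_neqAle eq_sym t0' t0.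
  have tp1 : (0 < 1 - t)%R.
    by rewrite Num.Theory.subr_gt0 Order.POrderTheory.lt_neqAle t1' t1.
  (* In the interior of an edge the support of the coordinates is its pair of ends, and the support
     is invariant. *)
  have psupp z : (p z != 0%R) = (z == x) || (z == y).
    rewrite pE; case: (z == x); case: (z == y) => /=;
      rewrite ?GRing.mulr0 ?GRing.mulr1 ?GRing.addr0 ?GRing.add0r ?eqxx //.
    - by rewrite GRing.subrK GRing.oner_neq0.
    - by rewrite Num.Theory.lt0r_neq0.
  have [xy'|xy'] := eqVneq x y.
    apply: (single x) => z; rewrite pE -xy' -GRing.mulrDl.
    by rewrite GRing.subrK GRing.mul1r.
  exists x, y; split; first by right.
  move=> g.
  have gx : (act g x == x) || (act g x == y).
    by rewrite -psupp -(pinv g) gactK psupp eqxx.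
  have gy : (act g y == x) || (act g y == y).
    by rewrite -psupp -(pinv g) gactK psupp eqxx orbT.
  case/orP: gx => /eqP gx; case/orP: gy => /eqP gy; [|by left|by right|].
    by case/eqP: xy'; apply: (@gact_inj g); rewrite gx gy.
  by case/eqP: xy'; apply: (@gact_inj g); rewrite gx gy.
(* The midpoint is the point that survives a flip of the edge. *)
exists (fun z => ((2^-1) * (z == x)%:R + 2^-1 * (z == y)%:R)%R).
  exists x, y, (2^-1)%R; split=> //.
    apply/andP; split; first by rewrite Num.Theory.invr_ge0 Num.Theory.ler0n.
    by rewrite Num.Theory.invf_le1 ?Num.Theory.ltr0n // Num.Theory.ler1n.
  move=> z; congr (_ * _ + _)%R.
  by rewrite [X in (X - _)%R](Num.Theory.splitr 1%R) GRing.mul1r GRing.addrK.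
by move=> g z; rewrite !gactV_eq; case: (inv g) => -[-> ->] //; rewrite GRing.addrC.
Qed.

End FixedPair.

(** * Groups of permutations, subgroups, presentations *)

(** The inverse is stored as data, so inversion in the group is a swap of fields; [sym_eq] shows
    that it adds no information. *)
Record sym (S : Type) := MkSym {
  sym_fun :> S -> S;
  sym_inv : S -> S;
  sym_funK : cancel sym_fun sym_inv;
  sym_invK : cancel sym_inv sym_fun
}.

Section SymGroup.
Variable S : Type.
Implicit Types p q : sym S.

Lemma sym_eq p q : p =1 q -> p = q.
Proof.
case: p => f g fK gK; case: q => f' g' fK' gK' /= /funext ff'.
rewrite -{}ff' in fK' gK' *.
have gg' : g = g' by apply/funext => x; rewrite -{1}[x]gK' fK.
by rewrite -{}gg' in fK' gK' *; congr MkSym; apply: Prop_irrelevance.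
Qed.

HB.instance Definition _ := gen_eqMixin (sym S).
HB.instance Definition _ := gen_choiceMixin (sym S).

Definition sym_one : sym S := @MkSym S id id (frefl _) (frefl _).
Definition sym_mul p q : sym S :=
  MkSym (can_comp (sym_funK p) (sym_funK q)) (can_comp (sym_invK q) (sym_invK p)).
Definition sym_opp p : sym S := MkSym (sym_invK p) (sym_funK p).

Lemma sym_mulA : associative sym_mul.
Proof. by move=> p q r; apply: sym_eq. Qed.
Lemma sym_mul1 : left_id sym_one sym_mul.
Proof. by move=> p; apply: sym_eq. Qed.
Lemma sym_mulr1 : right_id sym_one sym_mul.
Proof. by move=> p; apply: sym_eq. Qed.
Lemma sym_mulV : left_inverse sym_one sym_opp sym_mul.
Proof. by move=> p; apply: sym_eq => x; apply: sym_funK. Qed.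
Lemma sym_mulrV : right_inverse sym_one sym_opp sym_mul.
Proof. by move=> p; apply: sym_eq => x; apply: sym_invK. Qed.

HB.instance Definition _ := isGroup.Build (sym S)
  sym_mulA sym_mul1 sym_mulr1 sym_mulV sym_mulrV.

Lemma symM p q x : (p * q) x = p (q x). Proof. by []. Qed.
Lemma sym1 x : (1 : sym S) x = x. Proof. by []. Qed.

End SymGroup.

Section SubgroupType.
Variables (G : groupType) (H : set G) (Hsub : is_subgroup H).

Definition subgroup_type of is_subgroup H : Type := {x : G | `[< H x >]}.
Local Notation K := (subgroup_type Hsub).

Definition hval (x : K) : G := sval x.
Definition hsub (x : G) (Hx : H x) : K := exist _ x (asboolT Hx).

Lemma hvalP (x : K) : H (hval x).
Proof. by case: x => x Hx; apply/asboolP. Qed.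

Lemma hval_inj : injective hval.
Proof. by move=> x y xy; apply: val_inj. Qed.

HB.instance Definition _ := Choice.copy K {x : G | `[< H x >]}.

Let H1 : H 1. Proof. by case: Hsub. Qed.
Let HM x y : H x -> H y -> H (x * y). Proof. by case: Hsub => _ + _; apply. Qed.
Let HV x : H x -> H x^-1. Proof. by case: Hsub => _ _; apply. Qed.

Definition sg_one : K := hsub H1.
Definition sg_mul (x y : K) : K := hsub (HM (hvalP x) (hvalP y)).
Definition sg_inv (x : K) : K := hsub (HV (hvalP x)).

Lemma sg_mulA : associative sg_mul.
Proof. by move=> x y z; apply: hval_inj; rewrite /= mulgA. Qed.
Lemma sg_mul1 : left_id sg_one sg_mul.
Proof. by move=> x; apply: hval_inj; rewrite /= mul1g. Qed.
Lemma sg_mulr1 : right_id sg_one sg_mul.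
Proof. by move=> x; apply: hval_inj; rewrite /= mulg1. Qed.
Lemma sg_mulV : left_inverse sg_one sg_inv sg_mul.
Proof. by move=> x; apply: hval_inj; rewrite /= mulVg. Qed.
Lemma sg_mulrV : right_inverse sg_one sg_inv sg_mul.
Proof. by move=> x; apply: hval_inj; rewrite /= mulgV. Qed.

HB.instance Definition _ := isGroup.Build K
  sg_mulA sg_mul1 sg_mulr1 sg_mulV sg_mulrV.

Lemma hvalM (x y : K) : hval (x * y) = hval x * hval y.
Proof. by []. Qed.

End SubgroupType.

Section PackMultiplicative.
Variables (G K : groupType) (f : G -> K) (fM : {morph f : x y / x * y}).

HB.instance Definition _ := isMultiplicative.Build G K f fM.
Definition pack_mult : {multiplicative G -> K} := f.

End PackMultiplicative.

Section MultLemmas.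
Variables (G K : groupType) (f : {multiplicative G -> K}).

Lemma multM x y : f (x * y) = f x * f y. Proof. exact: gmulfM. Qed.
Lemma mult1 : f 1 = 1.
Proof. by apply: (mulgI (f 1)); rewrite -multM !mulg1. Qed.
Lemma multV x : f x^-1 = (f x)^-1.
Proof. by apply: (mulgI (f x)); rewrite -multM !mulgV mult1. Qed.

End MultLemmas.

Section PresentedHom.
Variables (X : choiceType) (rels : word X -> word X -> Prop).
Local Notation Gam := (presented_group rels).

Lemma presented_ind (P : set Gam) :
  is_subgroup P -> (forall x, P (presented_gen rels x)) -> forall a, P a.
Proof.
move=> [P1 PM PV] Pgen a; rewrite -[a]reprK.
elim: (generic_quotient.repr a) => [|[x b] w IHw]; first exact: P1.
suff -> : \pi_Gam ((x, b) :: w : word X) =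
    (if b then presented_gen rels x else (presented_gen rels x)^-1)
      * \pi_Gam (w : word X).
  by apply: PM => //; case: b => //; apply: PV.
by case: b; rewrite ?[(_)^-1]presented_invE [RHS]presented_mulE.
Qed.

Variables (K : groupType) (j : X -> K).

Definition weval (w : word X) : K :=
  foldr (fun a k => (if a.2 then j a.1 else (j a.1)^-1) * k) 1 w.

Lemma weval_cat u v : weval (u ++ v) = weval u * weval v.
Proof. by elim: u => [|a u IHu] /=; rewrite ?mul1g // IHu mulgA. Qed.

Hypothesis jrels : forall u v, rels u v -> weval u = weval v.

Lemma weval_congr u v : word_congr rels u v -> weval u = weval v.
Proof.
elim=> {u v} //=.
- by move=> x []; rewrite /= mulg1 ?mulgV ?mulVg.
- by move=> u v w _ -> _ ->.
- by move=> u u' v v' _ uu' _ vv'; rewrite !weval_cat uu' vv'.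
Qed.

Definition presented_hom_fun (a : Gam) : K := weval (generic_quotient.repr a).

Lemma presented_hom_funE w : presented_hom_fun (\pi w) = weval w.
Proof. exact/weval_congr/presented_reprK. Qed.

Lemma presented_hom_funM : {morph presented_hom_fun : a b / a * b}.
Proof.
move=> a b; rewrite -[a]reprK -[b]reprK [_ * _]presented_mulE.
by rewrite !presented_hom_funE weval_cat.
Qed.

Definition presented_hom : {multiplicative Gam -> K} :=
  pack_mult presented_hom_funM.

Lemma presented_hom_gen x : presented_hom (presented_gen rels x) = j x.
Proof. by rewrite /= presented_hom_funE /= mulg1. Qed.

End PresentedHom.

(** * Equivariant bijections *)

Section EquivariantBijections.
Variables (C : groupType) (S : choiceType).
Implicit Types a b : {multiplicative C -> sym S}.

Lemma multVK a c x : a c^-1 (a c x) = x.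
Proof. by rewrite -symM -multM mulVg mult1. Qed.

(* Cantor-Bernstein: the usual bijection commutes with whatever [j1] and [j2]
   commute with. *)
Lemma equivariant_bernstein a b (j1 j2 : S -> S) :
  injective j1 -> injective j2 ->
  (forall c x, j1 (a c x) = b c (j1 x)) ->
  (forall c x, j2 (b c x) = a c (j2 x)) ->
  exists p : sym S, forall c, p * a c = b c * p.
Proof.
move=> inj1 inj2 j1E j2E.
pose A x := exists n y, (forall z, y <> j2 z) /\ x = iter n (j2 \o j1) y.
have aA c x : A x -> A (a c x).
  move=> [n [y [yj ->]]]; exists n, (a c y); split.
    by move=> z /(congr1 (a c^-1)); rewrite multVK -j2E; apply: yj.
  by elim: n => //= n IHn; rewrite -j2E -j1E IHn.
have AV c x : A (a c x) -> A x by move=> /(aA c^-1); rewrite multVK.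
have A21 x : A x -> A (j2 (j1 x)).
  by move=> [n [y [yj ->]]]; exists n.+1, y.
(* The bijection is [j1] on [A] and a preimage under [j2] off [A]; a point without such a preimage
   lies in [A] with [n = 0]. *)
have exq x : exists z, (A x -> z = j1 x) /\ (~ A x -> x = j2 z).
  have [Ax|nAx] := pselect (A x); first by exists (j1 x); split.
  suff [z xz] : exists z, x = j2 z by exists z; split.
  apply: contrapT => nz; apply: nAx; exists 0, x; split=> // z xz.
  by apply: nz; exists z.
have [q qE] := choice exq.
have qA x : A x -> q x = j1 x by case: (qE x).
have qnA x : ~ A x -> x = j2 (q x) by case: (qE x).
have injq : injective q.
  move=> x x' qxx'; have [Ax|nAx] := pselect (A x); last first.
    have [Ax'|nAx'] := pselect (A x'); last by rewrite (qnA x) // qxx' -qnA.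
    by case: (nAx); rewrite (qnA x) // qxx' qA //; apply: A21.
  have [Ax'|nAx'] := pselect (A x'); first by apply: inj1; rewrite -!qA.
  by case: (nAx'); rewrite (qnA x') // -qxx' qA //; apply: A21.
have surjq z : exists x, q x = z.
  have [[n [y [yj e]]]|nA] := pselect (A (j2 z)); last first.
    by exists (j2 z); apply: inj2; rewrite -qnA.
  case: n e => [/esym/yj //|n] /= /inj2 ->.
  by exists (iter n (j2 \o j1) y); apply: qA; exists n, y.
have [r rK] := choice surjq.
have qK : cancel q r by move=> x; apply: injq.
exists (MkSym qK rK) => c; apply: sym_eq => x; rewrite !symM /=.
have [Ax|nAx] := pselect (A x); first by rewrite !qA //; apply: aA.
apply: inj2; rewrite j2E -!qnA // => /AV; exact: nAx.
Qed.

(* Any set of orbit representatives for the free action [a] is mapped by [s] into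
   distinct free orbits of [b]. *)
Lemma equivariant_embedding a b (s : S -> S) :
  (forall c x, a c x = x -> c = 1) ->
  (forall c c' x x', b c (s x) = b c' (s x') -> c = c' /\ x = x') ->
  exists2 j : S -> S, injective j & forall c x, j (a c x) = b c (j x).
Proof.
move=> afree sfree.
pose rep x := xget x [set y | exists c, x = a c y].
have repP x : exists c, x = a c (rep x).
  by rewrite /rep; case: xgetP => // /(_ x) []; exists 1; rewrite mult1.
have repE c x : rep (a c x) = rep x.
  have e : [set y | exists c', a c x = a c' y] = [set y | exists c', x = a c' y].
    apply/seteqP; split=> y [c' /= e].
      by exists (c^-1 * c'); rewrite multM symM -e multVK.
    by exists (c * c'); rewrite multM symM -e.
  (* The two uses of [xget] differ only in their default, which is never taken because an orbit is
     nonempty. *)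
  rewrite /rep e /xget; case: pselect => // -[]; exists x; apply/asboolP.
  by exists 1; rewrite mult1.
have [g gE] := choice repP.
(* The element carrying the orbit representative to [x] is unique by freeness, hence depends
   equivariantly on [x]. *)
have gM c x : g (a c x) = c * g x.
  apply/esym/(mulgI (g (a c x))^-1); rewrite mulVg; apply: (afree _ (rep x)).
  rewrite [in X in X = _]multM !symM multM symM -gE -{1}(repE c x).
  by rewrite {2}(gE (a c x)) multVK.
exists (fun x => b (g x) (s (rep x))).
  by move=> x x' /sfree[gg rr]; rewrite (gE x) (gE x') gg rr.
by move=> c x; rewrite gM repE multM symM.
Qed.


End EquivariantBijections.

(** * The fundamental group of a graph of groups *)

Section FundamentalGroupTheory.
Variables (A : finite_graph_of_groups) (T : {set gg_edge A}).
Local Notation Gam := (fundamental_group T).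
Local Notation vE := (vertex_elt T).
Local Notation eE := (edge_elt T).

Lemma vertex_eltM v (g h : vertex_group v) : vE (g * h) = vE g * vE h.
Proof.
rewrite [RHS]presented_mulE; apply/word_piP/word_congr_sym/word_congr_rel.
exact: fg_rel_vertex.
Qed.

Definition vertex_hom v : {multiplicative vertex_group v -> Gam} :=
  pack_mult (@vertex_eltM v).

Lemma vertex_elt1 v : vE (1 : vertex_group v) = 1.
Proof. exact: (mult1 (vertex_hom v)). Qed.

Lemma vertex_eltV v (g : vertex_group v) : vE g^-1 = (vE g)^-1.
Proof. exact: (multV (vertex_hom v)). Qed.

Lemma edge_eltP e (c : edge_group e) :
  vE (src_mono e c) * eE e = eE e * vE (tgt_mono e c).
Proof.
suff <- : (eE e)^-1 * (vE (src_mono e c) * eE e) = vE (tgt_mono e c).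
  by rewrite mulVKg.
rewrite [_^-1]presented_invE [vE _ * _]presented_mulE [LHS]presented_mulE.
exact/word_piP/word_congr_rel/fg_rel_edge.
Qed.

Lemma edge_elt_tree e : e \in T -> eE e = 1.
Proof. by move=> eT; apply/word_piP/word_congr_rel/fg_rel_tree. Qed.

Lemma fundamental_group_ind (P : set Gam) : is_subgroup P ->
  (forall v (g : vertex_group v), P (vE g)) -> (forall e, P (eE e)) ->
  forall a, P a.
Proof.
by move=> Psub Pv Pe; apply: presented_ind => // -[[v g]|e]; [apply: Pv|apply: Pe].
Qed.

Lemma fundamental_group_hom (K : groupType)
    (rho : forall v, {multiplicative vertex_group v -> K})
    (p : gg_edge A -> K) :
  (forall e c, rho _ (src_mono e c) * p e = p e * rho _ (tgt_mono e c)) ->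
  (forall e, e \in T -> p e = 1) ->
  exists f : {multiplicative Gam -> K},
    (forall v (g : vertex_group v), f (vE g) = rho v g) /\
    (forall e, f (eE e) = p e).
Proof.
move=> edge_rel tree_rel.
pose j (x : fg_gen A) : K :=
  match x with inl g => rho (tag g) (tagged g) | inr e => p e end.
have jrels u v : fg_rels T u v -> weval j u = weval j v.
  case=> {u v} [v g h|e c|e eT] /=; rewrite !mulg1.
  - by rewrite multM.
  - by rewrite edge_rel mulKg.
  - exact: tree_rel.
exists (presented_hom jrels); split=> [v g|e].
  exact: (presented_hom_gen jrels (inl (Tagged (@vertex_group A) g))).
exact: (presented_hom_gen jrels (inr e)).
Qed.

Hypothesis sT : spanning_tree T.

(* A parallel section over the spanning tree, for transport maps [f e] along the
   edges. *)
Lemma tree_section (K : Type) (k0 : K) (f g : gg_edge A -> K -> K) :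
  (forall e, cancel (f e) (g e)) -> (forall e, cancel (g e) (f e)) ->
  exists k : gg_vertex A -> K,
    forall e, e \in T -> k (gg_tgt e) = f e (k (gg_src e)).
Proof.
move=> fK gK; have [treeT injT] := sT.
have [[r] _ _ _ _] := treeT.
have [h [[sadj iadj _ low] _ hdiff]] := is_tree_height r treeT.
have adjT e : e \in T -> edges_adj T (gg_src e) (gg_tgt e).
  by move=> eT; apply/existsP; exists e; rewrite eT !eqxx.
(* The parent of [v] is unique by [low], and the edge leading to it is unique since [T] has no
   multiple edges. *)
have uniqT v e e' x x' : e \in T -> e' \in T ->
    [set gg_src e; gg_tgt e]%SET = [set v; x]%SET ->
    [set gg_src e'; gg_tgt e']%SET = [set v; x']%SET ->
    h x <= h v -> h x' <= h v -> e = e'.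
  move=> eT e'T se se' hx hx'; apply: injT => //; rewrite se se'.
  suff adjv z d : d \in T -> [set gg_src d; gg_tgt d]%SET = [set v; z]%SET ->
      edges_adj T v z.
    by rewrite (low v x x') //; [apply: (adjv _ e)|apply: (adjv _ e')].
  move=> dT dvz; have nst : gg_src d != gg_tgt d.
    by apply/negP => /eqP st; have := adjT _ dT; rewrite st iadj.
  have /set2P[sv|sz] : gg_src d \in [set v; z]%SET by rewrite -dvz !inE eqxx.
    have : z \in [set gg_src d; gg_tgt d]%SET by rewrite dvz !inE eqxx orbT.
    rewrite !inE sv => /orP[/eqP zv|/eqP ->]; last by rewrite -sv adjT.
    have : gg_tgt d \in [set v; z]%SET by rewrite -dvz !inE eqxx orbT.
    by rewrite zv !inE orbb eq_sym -sv (negbTE nst).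
  have : v \in [set gg_src d; gg_tgt d]%SET by rewrite dvz !inE eqxx.
  rewrite !inE sz => /orP[/eqP zv|/eqP ->]; last by rewrite sadj -sz adjT.
  have : gg_tgt d \in [set v; z]%SET by rewrite -dvz !inE eqxx orbT.
  by rewrite zv !inE orbb eq_sym -sz (negbTE nst).
(* The fuel [n] is the height of [v]. The value comes from the parent, by [g e] or [f e] according
   to the orientation of the edge, and is [k0] at the root. *)
pose fix sec (n : nat) (v : gg_vertex A) {struct n} : K := if n is m.+1 then
  if [pick e in T | (gg_src e == v) && (h (gg_tgt e) < h v)] is Some e
  then g e (sec m (gg_tgt e)) else
  if [pick e in T | (gg_tgt e == v) && (h (gg_src e) < h v)] is Some e
  then f e (sec m (gg_src e)) else k0 else k0.
exists (fun v => sec (h v) v) => e eT; cbv beta.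
have [hst|hts] := hdiff _ _ (adjT e eT).
  rewrite hst /=; case: pickP => [e' /and3P[e'T /eqP se' he']|/(_ e)].
    have <- : e = e'.
      apply: (uniqT (gg_src e) _ _ (gg_tgt e) (gg_tgt e')) => //.
      - by rewrite se'.
      - by rewrite hst.
      - exact: ltnW.
    by rewrite gK.
  by rewrite /= eT eqxx hst ltnS leqnn.
rewrite hts /=; case: pickP => [e' /and3P[e'T /eqP se' he']|_].
  have ee' : e = e'.
    apply: (uniqT (gg_tgt e) _ _ (gg_src e) (gg_tgt e')) => //.
    - by rewrite finset.setUC.
    - by rewrite se'.
    - by rewrite hts.
    - exact: ltnW.
  by move: he'; rewrite -ee' ltnn.
case: pickP => [e' /and3P[e'T /eqP te' he']|/(_ e)].
  have <- // : e = e'.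
    apply: (uniqT (gg_tgt e) _ _ (gg_src e) (gg_src e')) => //.
    - by rewrite finset.setUC.
    - by rewrite te' finset.setUC.
    - by rewrite hts.
    - exact: ltnW.
by rewrite /= eT eqxx hts ltnS leqnn.
Qed.

End FundamentalGroupTheory.

(** * Vertex groups embed *)

Section Conjugation.
Variable K : groupType.

Definition conj_fun (k x : K) : K := k * x * k^-1.

Lemma conj_funM k : {morph conj_fun k : x y / x * y}.
Proof. by move=> x y; rewrite /conj_fun !mulgA mulgVK. Qed.

Definition conj_hom k : {multiplicative K -> K} := pack_mult (conj_funM k).

End Conjugation.

Section FreeSet.
Variables (I : eqType) (E : I -> groupType).

(* [E i] acts freely on [free_set] through the coordinate [(i, 0)]; the other
   coordinates leave room for [shift] to embed [E i * free_set] equivariantly. *)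
Definition free_set : choiceType := forall i, nat -> E i.
Implicit Types s : free_set.

Definition lact_fun i (g : E i) s : free_set :=
  @eqtype.dfwith I (fun j => nat -> E j) s i
    (fun n => if n is 0 then g * s i 0 else s i n).

Lemma lact_funE i g s : @lact_fun i g s i 0 = g * s i 0.
Proof. by rewrite /lact_fun eqtype.dfwith_in. Qed.

Lemma lact_funS i g s k n : @lact_fun i g s k n.+1 = s k n.+1.
Proof.
rewrite /lact_fun; case: (eqVneq i k) => [<-|ik].
  by rewrite eqtype.dfwith_in.
by rewrite eqtype.dfwith_out.
Qed.

Lemma lact_fun_out i g s k n : i != k -> @lact_fun i g s k n = s k n.
Proof. by move=> ik; rewrite /lact_fun eqtype.dfwith_out. Qed.

Lemma free_set_eq s s' : (forall i n, s i n = s' i n) -> s = s'.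
Proof. by move=> ss'; apply: functional_extensionality_dep => i; apply/funext. Qed.

Lemma lact_fun1 i s : lact_fun (1 : E i) s = s.
Proof.
apply: free_set_eq => k [|n]; last exact: lact_funS.
case: (eqVneq i k) => [<-|ik]; last exact: lact_fun_out.
by rewrite lact_funE mul1g.
Qed.

Lemma lact_funM i (g h : E i) s : lact_fun (g * h) s = lact_fun g (lact_fun h s).
Proof.
apply: free_set_eq => k [|n]; last by rewrite !lact_funS.
case: (eqVneq i k) => [<-|ik]; last by rewrite !lact_fun_out.
by rewrite !lact_funE mulgA.
Qed.

Lemma lact_funK i (g : E i) : cancel (lact_fun g) (lact_fun g^-1).
Proof. by move=> s; rewrite -lact_funM mulVg lact_fun1. Qed.

Lemma lact_funVK i (g : E i) : cancel (lact_fun g^-1) (lact_fun g).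
Proof. by move=> s; rewrite -lact_funM mulgV lact_fun1. Qed.

Definition lact_sym i (g : E i) : sym free_set :=
  MkSym (lact_funK g) (lact_funVK g).

Lemma lact_symM i : {morph @lact_sym i : g h / g * h}.
Proof. by move=> g h; apply: sym_eq => s; apply: lact_funM. Qed.

Definition lact i : {multiplicative E i -> sym free_set} :=
  pack_mult (@lact_symM i).

Lemma lact_free i (g g' : E i) s : lact i g s = lact i g' s -> g = g'.
Proof.
by move=> /(congr1 (fun s' : free_set => s' i 0)); rewrite /= !lact_funE => /mulIg.
Qed.

Definition shift s : free_set := fun i n => if n is m.+1 then s i m else 1.

Lemma lact_shift_inj i (g g' : E i) s s' :
  lact i g (shift s) = lact i g' (shift s') -> g = g' /\ s = s'.
Proof.
move=> e; have ss' : s = s'.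
  apply: free_set_eq => k n.
  by have := congr1 (fun x : free_set => x k n.+1) e; rewrite /= !lact_funS.
by rewrite -ss' in e *; split=> //; apply: lact_free e.
Qed.

(** Injectivity of [a] and [b] makes both actions of [C] free. Embedding each in the other avoids
    counting the orbits, that is, the cosets of the images of [C]. *)
Lemma lact_conj (C : groupType) i k (a : {multiplicative C -> E i})
    (b : {multiplicative C -> E k}) :
  injective a -> injective b ->
  exists p : sym free_set, forall c, lact i (a c) * p = p * lact k (b c).
Proof.
move=> inja injb.
have aM : {morph (fun c => lact i (a c)) : c d / c * d}.
  by move=> c d; cbv beta; rewrite (multM a) (multM (lact i)).
have bM : {morph (fun c => lact k (b c)) : c d / c * d}.
  by move=> c d; cbv beta; rewrite (multM b) (multM (lact k)).
pose a' := pack_mult aM; pose b' := pack_mult bM.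
have [j1 inj1 j1E] : exists2 j, injective j &
    forall c x, j (a' c x) = b' c (j x).
  apply: (@equivariant_embedding _ _ a' b' shift).
    move=> c x; rewrite -{2}[x](sym1 x) -(mult1 (lact i)) => /lact_free.
    by rewrite -(mult1 a); apply: inja.
  by move=> c c' x x' /lact_shift_inj[/injb -> ->].
have [j2 inj2 j2E] : exists2 j, injective j &
    forall c x, j (b' c x) = a' c (j x).
  apply: (@equivariant_embedding _ _ b' a' shift).
    move=> c x; rewrite -{2}[x](sym1 x) -(mult1 (lact k)) => /lact_free.
    by rewrite -(mult1 b); apply: injb.
  by move=> c c' x x' /lact_shift_inj[/inja -> ->].
have [p pE] := equivariant_bernstein inj2 inj1 j2E j1E.
by exists p => c; rewrite -[LHS]/(a' c * p) -pE.
Qed.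

End FreeSet.

Section VertexInjective.
Variables (A : finite_graph_of_groups) (T : {set gg_edge A}).
Hypothesis sT : spanning_tree T.

Lemma vertex_elt_inj v : injective (@vertex_elt A T v).
Proof.
pose S := free_set (@vertex_group A).
(* [p0 e] intertwines the two actions of the edge group, as the edge relation demands of the image
   of the letter of [e]. *)
have [p0 p0E] := choice (fun e : gg_edge A =>
  lact_conj (@src_mono_inj A e) (@tgt_mono_inj A e)).
(* The edges of the spanning tree must act trivially: change the action of each
   vertex group by the conjugation that achieves this. *)
have [||k kE] := @tree_section A T sT (sym S) 1 (fun e x => x * p0 e)
  (fun e x => x * (p0 e)^-1).
- by move=> e x; rewrite mulgK.
- by move=> e x; rewrite mulgVK.
pose rho w : {multiplicative vertex_group w -> sym S} := 
  conj_hom (k w) \o lact (@vertex_group A) w.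
have [||f [fv _]] := @fundamental_group_hom A T (sym S) rho
  (fun e => k (gg_src e) * p0 e * (k (gg_tgt e))^-1).
- move=> e c; rewrite /= /conj_fun !mulgA !mulgVK.
  by rewrite -[k _ * lact _ _ _ * _]mulgA p0E !mulgA.
- by move=> e eT; rewrite kE // mulgV.
move=> g h /(congr1 f); rewrite !fv /= /conj_fun => /mulIg/mulgI gh.
apply: (@lact_free _ (@vertex_group A) v g h (fun _ _ => 1)).
exact: (congr1 (fun p : sym S => p _) gh).
Qed.

End VertexInjective.

(** * The Bass-Serre tree *)

Section BassSerreGraph.
Variables (A : finite_graph_of_groups) (T : {set gg_edge A}).
Local Notation Gam := (fundamental_group T).
Local Notation vE := (vertex_elt T).
Local Notation eE := (edge_elt T).
Local Notation BS := (bs_vertex T).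
Implicit Types (v w : gg_vertex A) (g h : Gam) (x y : BS).

Lemma bs_vertexP x : exists v g, x = bs_coset v g.
Proof.
case: x => -[v C] vC; have /asboolP[g /= gC] := vC; exists v, g.
by apply: val_inj; rewrite /= gC.
Qed.

Lemma bs_coset_eqP v g h :
  bs_coset v g = bs_coset v h <-> exists k : vertex_group v, h = g * vE k.
Proof.
split=> [/(congr1 val)[e]|[k ->]].
  have : left_coset h (range (@vertex_elt A T v)) h.
    by exists 1; rewrite ?mulg1 //; exists 1; rewrite ?vertex_elt1.
  by rewrite -e => -[_ [k _ <-] <-]; exists k.
apply: val_inj; congr (_, _); apply/seteqP; split=> a [_ [l _ <-] <-].
  exists (vE (k^-1 * l)); first by exists (k^-1 * l).
  by rewrite vertex_eltM vertex_eltV -mulgA mulVKg.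
exists (vE (k * l)); first by exists (k * l).
by rewrite vertex_eltM mulgA.
Qed.

Lemma bs_coset_vertex v w g h : bs_coset v g = bs_coset w h -> v = w.
Proof. by move=> /(congr1 val)[]. Qed.

Lemma bs_act_coset g v h : bs_act g (bs_coset v h) = bs_coset v (g * h).
Proof. by apply: val_inj; rewrite /= left_cosetM. Qed.

Lemma bs_act1 x : bs_act 1 x = x.
Proof. by have [v [g ->]] := bs_vertexP x; rewrite bs_act_coset mul1g. Qed.

Lemma bs_actM g h x : bs_act (g * h) x = bs_act g (bs_act h x).
Proof. by have [v [k ->]] := bs_vertexP x; rewrite !bs_act_coset mulgA. Qed.

Lemma bs_adj_edge e g :
  bs_adj (bs_coset (gg_src e) g) (bs_coset (gg_tgt e) (g * eE e)).
Proof. by apply/asboolP; exists e, g; left. Qed.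

Lemma bs_adj_sym : symmetric (@bs_adj A T).
Proof.
move=> x y; apply/asboolP/asboolP => -[e [g xy]]; exists e, g => /=;
  by case: xy => -[-> ->]; [right|left].
Qed.

Lemma bs_adjP x y (P : BS -> BS -> Prop) :
  (forall a b, P a b -> P b a) ->
  (forall e g, P (bs_coset (gg_src e) g) (bs_coset (gg_tgt e) (g * eE e))) ->
  bs_adj x y -> P x y.
Proof. by move=> Psym Pe /asboolP[e [g /= [[-> ->]|[-> ->]]]] //; apply: Psym. Qed.

Lemma bs_adj_act g x y : bs_adj (bs_act g x) (bs_act g y) = bs_adj x y.
Proof.
have act h a b : bs_adj a b -> bs_adj (bs_act h a) (bs_act h b).
  apply: (@bs_adjP a b (fun a b => bs_adj (bs_act h a) (bs_act h b))).
    by move=> {}a {}b; rewrite bs_adj_sym.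
  by move=> e k; rewrite !bs_act_coset mulgA bs_adj_edge.
apply/idP/idP => [/(act g^-1)|/act //].
by rewrite -!bs_actM mulVg !bs_act1.
Qed.

Hypothesis sT : spanning_tree T.

Lemma bs_reach x y : reach (@bs_adj A T) x y.
Proof.
have base v w : reach (@bs_adj A T) (bs_coset v 1) (bs_coset w 1).
  have [[_ _ _ conn _] _] := sT.
  apply: (@reach_ind_set _ (edges_adj T)
    (fun u => reach (@bs_adj A T) (bs_coset v 1) (bs_coset u 1)) v w _ _
    (conn v w)); last exact: reach_refl.
  move=> a b va /existsP[e /andP[eT ab]].
  apply: reach_trans va (reach_edge _).
  have := bs_adj_edge e 1; rewrite (edge_elt_tree eT) mulg1.
  by case/orP: ab => /andP[/eqP -> /eqP ->] //; rewrite bs_adj_sym.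
pose b0 v := bs_coset v (1 : Gam).
have reach_act g a b : reach (@bs_adj A T) a b ->
    reach (@bs_adj A T) (bs_act g a) (bs_act g b).
  apply: (@reach_ind_set _ _ (fun b =>
    reach (@bs_adj A T) (bs_act g a) (bs_act g b))); last exact: reach_refl.
  move=> c d ac cd; apply: reach_trans ac (reach_edge _).
  by rewrite bs_adj_act.
(* The elements that move each base vertex within its component form a subgroup; it contains the
   generators. *)
have gen g : forall v, reach (@bs_adj A T) (b0 v) (bs_act g (b0 v)).
  move: g; apply: fundamental_group_ind.
  - split=> [v|g h IHg IHh v|g IHg v]; first by rewrite bs_act1; apply: reach_refl.
      by rewrite bs_actM; apply: reach_trans (IHg v) (reach_act _ _ _ (IHh v)).
    apply: (reach_sym bs_adj_sym); rewrite -[X in reach _ _ X]bs_act1.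
    by rewrite -(mulVg g) bs_actM; apply: reach_act.
  - move=> w k v; apply: reach_trans (base v w) _.
    have -> : bs_coset w 1 = bs_act (vE k) (bs_coset w 1).
      by rewrite bs_act_coset mulg1; apply/bs_coset_eqP; exists k; rewrite mul1g.
    exact/reach_act/base.
  - move=> e v; apply: reach_trans (base v (gg_src e)) _.
    apply: (@reach_trans _ _ _ (bs_act (eE e) (b0 (gg_tgt e)))); last first.
      exact/reach_act/base.
    have := bs_adj_edge e 1.
    by rewrite bs_act_coset mulg1 mul1g => /reach_edge.
have [v [g ->]] := bs_vertexP x; have [w [h ->]] := bs_vertexP y.
have gE u k : bs_coset u k = bs_act k (b0 u) by rewrite bs_act_coset mulg1.
apply: reach_trans (reach_trans (reach_sym bs_adj_sym _) (base v w)) _.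
  by rewrite (gE v g); apply: gen.
by rewrite (gE w h); apply: gen.
Qed.

End BassSerreGraph.

Section BassSerreTree.
Variables (A : finite_graph_of_groups) (T : {set gg_edge A}).
Local Notation Gam := (fundamental_group T).
Local Notation vE := (vertex_elt T).
Local Notation eE := (edge_elt T).
Local Notation BS := (bs_vertex T).

(* 1-chains with coefficients in the field with two elements. *)
Definition chain : Type := BS -> BS -> bool.
Implicit Types a b c : chain.

Definition addc a b : chain := fun x y => a x y (+) b x y.
Definition edge_chain (x y : BS) : chain := fun u v =>
  ((u == x) && (v == y)) || ((u == y) && (v == x)).
Definition linc (g : Gam) a : chain := fun x y => a (bs_act g^-1 x) (bs_act g^-1 y).

Lemma chain_eq a b : (forall x y, a x y = b x y) -> a = b.
Proof. by move=> ab; apply/funext => x; apply/funext. Qed.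

Lemma addcA : associative addc.
Proof. by move=> a b c; apply: chain_eq => x y; apply: addbA. Qed.

Lemma addcK a : involutive (addc a).
Proof. by move=> b; apply: chain_eq => x y; rewrite /addc addKb. Qed.

Lemma lincD g a b : linc g (addc a b) = addc (linc g a) (linc g b).
Proof. by []. Qed.

Lemma linc1 a : linc 1 a = a.
Proof. by apply: chain_eq => x y; rewrite /linc invg1 !bs_act1. Qed.

Lemma lincM g h a : linc (g * h) a = linc g (linc h a).
Proof. by apply: chain_eq => x y; rewrite /linc invgM !bs_actM. Qed.

Lemma linc_edge g x y :
  linc g (edge_chain x y) = edge_chain (bs_act g x) (bs_act g y).
Proof.
apply: chain_eq => u v; rewrite /linc /edge_chain.
by rewrite !(gactV_eq (@bs_act1 A T) (@bs_actM A T)).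
Qed.

Lemma edge_chainC x y : edge_chain x y = edge_chain y x.
Proof. by apply: chain_eq => u v; rewrite /edge_chain orbC. Qed.

Definition trs a : sym chain := MkSym (addcK a) (addcK a).

Lemma lincK g : cancel (linc g) (linc g^-1).
Proof. by move=> a; rewrite -lincM mulVg linc1. Qed.

Lemma lincVK g : cancel (linc g^-1) (linc g).
Proof. by move=> a; rewrite -lincM mulgV linc1. Qed.

Definition lin (g : Gam) : sym chain := MkSym (lincK g) (lincVK g).

Lemma linM g h : lin (g * h) = lin g * lin h.
Proof. by apply: sym_eq => a; apply: lincM. Qed.

Lemma trsK a : trs a * trs a = 1.
Proof. by apply: sym_eq => b; apply: addcK. Qed.

Hypothesis sT : spanning_tree T.

(* [Gam] acts on chains by affine maps whose linear part is the natural
   action; the translation part of [g] is a path from a base point to its image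
   under [g]. The orbit of the origin splits the boundary map. *)
Lemma bs_potential : exists tau : BS -> chain,
  forall x y, bs_adj x y -> tau y = addc (tau x) (edge_chain x y).
Proof.
pose o v : BS := bs_coset v 1.
pose ep e := edge_chain (o (gg_src e)) (bs_act (eE e) (o (gg_tgt e))).
pose zero : chain := fun _ _ => false.
have addcc a : addc a a = zero by apply: chain_eq => x y; apply: addbb.
have add0 a : addc a zero = a by apply: chain_eq => x y; apply: addbF.
(* [t v] will be the potential of the base vertex [o v]: it changes by the chain of the edge along
   each edge of [T]. *)
have [||t tE] := @tree_section A T sT chain zero (fun e a => addc (ep e) a)
  (fun e a => addc (ep e) a).
- by move=> e a; apply: addcK.
- by move=> e a; apply: addcK.
(* Conjugating the linear action by the translation makes the vertex group fix [t v]. *)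
have rhoM v : {morph (fun k => trs (t v) * lin (vertex_hom T v k) * trs (t v)) :
    k l / k * l}.
  move=> k l; cbv beta; rewrite multM linM !mulgA; congr (_ * _).
  by rewrite -[_ * trs _ * trs _]mulgA trsK mulg1.
pose rho v := pack_mult (rhoM v).
have rhoE v k : rho v k = trs (t v) * lin (vE k) * trs (t v) by [].
(* Chosen to send [t (gg_tgt e)] to [t (gg_src e)] plus the edge from [o (gg_src e)], the potential
   required at its far end. *)
pose p e := trs (t (gg_src e)) * trs (ep e) * lin (eE e) * trs (t (gg_tgt e)).
have [||sg [sgv sge]] := @fundamental_group_hom A T (sym chain) rho p.
- move=> e c; rewrite !rhoE /p; apply: sym_eq => a; rewrite !symM /=.
  rewrite !addcK; congr addc; rewrite !lincD -!lincM edge_eltP; congr addc.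
  rewrite /ep linc_edge -!bs_actM edge_eltP; congr edge_chain.
    rewrite bs_act_coset mulg1; apply/esym/bs_coset_eqP.
    by exists (src_mono e c); rewrite mul1g.
  rewrite !bs_act_coset !mulg1; apply/esym/bs_coset_eqP.
  by exists (tgt_mono e c).
- move=> e eT; apply: sym_eq => a; rewrite /p !symM /= (tE e eT).
  rewrite (edge_elt_tree eT) linc1 -!addcA.
  by rewrite addcK addcK.
have aff g : forall a b, sg g (addc a b) = addc (sg g a) (linc g b).
  move: g; apply: fundamental_group_ind.
  - split=> [a b|g h IHg IHh a b|g IHg a b].
    + by rewrite mult1 linc1.
    + by rewrite multM !symM IHh IHg lincM.
    + apply: (can_inj (sym_funK (sg g))); rewrite IHg multV.
      by rewrite !sym_invK lincVK.
  - move=> v k a b; rewrite sgv rhoE !symM /=.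
    by rewrite !lincD !addcA.
  - by move=> e a b; rewrite sge /p !symM /= !lincD !addcA.
(* The value at a coset is independent of [g] because the vertex group fixes [t v]. *)
have [tau tauE] : exists tau : BS -> chain,
    forall v g, tau (bs_coset v g) = sg g (t v).
  have ex x : exists c, forall v g, x = bs_coset v g -> c = sg g (t v).
    have [v [g ->]] := bs_vertexP x; exists (sg g (t v)) => w h e.
    have vw := bs_coset_vertex e; move: vw h e => <- h /bs_coset_eqP[k ->].
    rewrite multM symM sgv rhoE !symM /=; congr (sg g _).
    by rewrite addcc (_ : linc _ zero = zero) // add0.
  have [tau tauE] := choice ex; exists tau => v g.
  exact: tauE.
exists tau => x y.
apply: (@bs_adjP A T x y (fun x y => tau y = addc (tau x) (edge_chain x y))).
  by move=> a b ->; rewrite (edge_chainC b a) -addcA addcc add0.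
move=> e g; rewrite !tauE multM symM sge /p !symM /=.
rewrite addcc (_ : linc _ zero = zero) // add0 aff; congr addc.
by rewrite /ep linc_edge !bs_act_coset !mulg1.
Qed.

Lemma bs_adj_irrefl : irreflexive (@bs_adj A T).
Proof.
have [tau tauE] := bs_potential.
move=> x; apply/negP => /tauE /(congr1 (fun c => c x x)).
by rewrite /addc /edge_chain !eqxx; case: (tau x x x).
Qed.

Theorem bs_tree : is_tree (@bs_adj A T).
Proof.
have [[[v] _ _ _ _] _] := sT.
apply: bridges_tree.
- by exists; apply: (bs_coset v 1).
- exact: bs_adj_sym.
- exact: bs_adj_irrefl.
- exact: bs_reach.
have [tau tauE] := bs_potential.
move=> x y xy r.
(* The coordinate of the potential at [(x, y)] is constant along walks avoiding that edge, but flips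
   across it. *)
have : tau x x y = tau y x y.
  apply: (@reach_ind_set _ _ (fun z => tau z x y = tau y x y) _ _ _ erefl r).
  move=> a b <- /andP[/tauE ->]; rewrite /addc /edge_chain => nab.
  rewrite (_ : _ || _ = false) ?addbF //; apply: contraNF nab.
  rewrite [a == _]eq_sym [b == _]eq_sym [a == y]eq_sym [b == x]eq_sym.
  by rewrite andbC [X in _ || X]andbC orbC.
rewrite (tauE _ _ xy) /addc /edge_chain !eqxx /=.
by case: (tau x x y).
Qed.

End BassSerreTree.

(** * Blowing up an orbit of vertices *)

Lemma finite_factor (X Y Z : Type) (D : set X) (p : X -> Y) (f : X -> Z) :
  finite_set [set p x | x in D] ->
  (forall x x', D x -> D x' -> p x = p x' -> f x = f x') ->
  finite_set [set f x | x in D].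
Proof.
move=> finp pf.
apply: (@sub_finite_set _ _ (\bigcup_(y in [set p x | x in D])
    [set f x | x in [set x | D x /\ p x = y]])).
  by move=> _ [x Dx <-]; exists (p x); [exists x|exists x].
apply: bigcup_finite => // _ [x0 Dx0 <-].
apply: (@sub_finite_set _ _ [set f x0]) => // _ [x [Dx pxx0] <-] /=.
exact: pf.
Qed.

Section LeftCosets.
Variables (G : groupType) (H : set G) (Hsub : is_subgroup H).

Lemma left_coset_eqP g h :
  left_coset g H = left_coset h H <-> exists2 k, H k & h = g * k.
Proof.
have [H1 HM HV] := Hsub; split=> [e|[k Hk ->]].
  have : left_coset h H h by exists 1; rewrite ?mulg1.
  by rewrite -e => -[k Hk <-]; exists k.
apply/seteqP; split=> a [l Hl <-].
  by exists (k^-1 * l); rewrite ?mulgA ?mulgK //; apply/HM => //; apply: HV.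
by exists (k * l); rewrite ?mulgA //; apply: HM.
Qed.

End LeftCosets.

Lemma left_cosetI (G : groupType) (H K : set G) g :
  left_coset g (H `&` K) = left_coset g H `&` left_coset g K.
Proof.
apply/seteqP; split=> [_ [k [Hk Kk] <-]|a [[k Hk <-] [l Kl /mulgI lk]]].
  by split; exists k.
by exists k => //; split=> //; rewrite -lk.
Qed.

Lemma is_subgroupI (G : groupType) (H K : set G) :
  is_subgroup H -> is_subgroup K -> is_subgroup (H `&` K).
Proof.
move=> [H1 HM HV] [K1 KM KV]; split=> //.
- by move=> x y [Hx Kx] [Hy Ky]; split; [apply: HM|apply: KM].
- by move=> x [Hx Kx]; split; [apply: HV|apply: KV].
Qed.

Section FinitelyGenerated.
Variable G : groupType.

Lemma generated_ind (s : seq G) (P : set G) :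
  smallest (@is_subgroup G) [set` s] = setT -> is_subgroup P ->
  (forall x, x \in s -> P x) -> forall g, P g.
Proof.
move=> gens Psub Ps g; have : smallest (@is_subgroup G) [set` s] g by rewrite gens.
by apply; split=> // x /Ps.
Qed.

(** Words in the indices of the generators form a countable type and evaluate onto [G]. *)
Lemma finitely_generated_enum :
  finitely_generated G -> exists f : nat -> G, forall g, exists n, f n = g.
Proof.
move=> [s gens].
pose ev := weval (fun i : nat => nth 1 s i).
have ev_inv w : ev (word_inv w) = (ev w)^-1.
  elim: w => [|[i b] w IHw]; first by rewrite /= invg1.
  rewrite -cat1s word_inv_cat /ev !weval_cat invgM -IHw; congr (_ * _).
  by case: b; rewrite /= !mulg1 ?invgK.
exists (fun n => if unpickle n is Some w then ev w else 1).
suff evP g : exists w, ev w = g.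
  by move=> g; have [w <-] := evP g; exists (pickle w); rewrite pickleK.
move: g; apply: (generated_ind gens).
  split; first by exists [::].
    by move=> _ _ [u <-] [v <-]; exists (u ++ v); rewrite /ev weval_cat.
  by move=> _ [u <-]; exists (word_inv u).
move=> x xs; exists [:: (index x s, true)].
by rewrite /ev /= mulg1 nth_index.
Qed.

End FinitelyGenerated.

Section StabilizerSubgroup.
Variables (G : groupType) (V : Type) (act : G -> V -> V).
Hypotheses (act1 : forall x, act 1 x = x)
  (actM : forall g h x, act (g * h) x = act g (act h x)).

Definition stabilizer x : set G := [set g | act g x = x].

Lemma stabilizer_subgroup x : is_subgroup (stabilizer x).
Proof.
rewrite /stabilizer; split=> [|g h /= gx hx|g /= gx] /=; first exact: act1.
  by rewrite actM hx gx.
by rewrite -{1}gx -actM mulVg act1.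
Qed.

End StabilizerSubgroup.

Section BlowUp.
Variables (G : groupType) (V : choiceType) (adj : rel V) (act : G -> V -> V).
Hypotheses (Genum : exists f : nat -> G, forall g, exists n, f n = g)
  (tadj : is_tree adj) (fadj : locally_finite adj)
  (sact : is_simplicial_action adj act) (nofix : ~ fixed_pair adj act).
Variable x0 : V.
Local Notation Stab := (stabilizer act x0).
(** Residual finiteness of [Stab], phrased with subgroups of [G] and cosets at elements of
    [Stab]. *)
Hypothesis separated : forall h, Stab h -> h <> 1 ->
  exists N : set G, [/\ is_subgroup N, N `<=` Stab, ~ N h
    & finite_set [set left_coset a N | a in Stab]].

Let act1 x : act 1 x = x. Proof. by case: sact. Qed.
Let actM g h x : act (g * h) x = act g (act h x). Proof. by case: sact. Qed.
Let act_adj g x y : adj (act g x) (act g y) = adj x y. Proof. by case: sact. Qed.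

(** Intersect, along an enumeration of [G], subgroups that each exclude one element; finite index
    persists because a coset of an intersection is an intersection of cosets. *)
Lemma stabilizer_chain : exists H : nat -> set G,
  [/\ forall n, is_subgroup (H n), forall n, H n `<=` Stab,
      forall n, H n.+1 `<=` H n, forall g, (forall n, H n g) -> g = 1
    & forall n, finite_set [set left_coset a (H n) | a in Stab]].
Proof.
have exN h : exists N : set G, [/\ is_subgroup N, N `<=` Stab,
    finite_set [set left_coset a N | a in Stab] & Stab h -> h <> 1 -> ~ N h].
  have [[Sh h1]|nS] := pselect (Stab h /\ h <> 1).
    by have [N [? ? ? ?]] := separated Sh h1; exists N.
  (* Default for elements that are trivial or outside [Stab]: there is nothing to exclude. *)
  exists Stab; split=> //; first exact: stabilizer_subgroup.
    apply: (@sub_finite_set _ _ [set Stab]) => // _ [a Sa <-] /=.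
    apply/seteqP; split=> [_ [b Sb <-]|b Sb].
      by have [_ SM _] := stabilizer_subgroup act1 actM x0; apply: SM.
    have [_ SM SV] := stabilizer_subgroup act1 actM x0.
    by exists (a^-1 * b); rewrite ?mulVKg //; apply: SM => //; apply: SV.
  by move=> Sh h1; case: nS.
have [N NP] := choice exN; have [f fsurj] := Genum.
pose fix H n := if n is m.+1 then H m `&` N (f m) else N 1.
have HS n : H n `<=` Stab.
  elim: n => [|n IHn] /=; first by case: (NP 1).
  by move=> g [/IHn].
exists H; split=> //.
- elim=> [|n IHn] /=; first by case: (NP 1).
  by apply: is_subgroupI => //; case: (NP (f n)).
- by move=> n g [].
- move=> g Hg; apply: contrapT => g1; have [n fn] := fsurj g.
  have [_ _ _ nN] := NP g; apply: nN => //; first exact: (HS 0 _ (Hg 0)).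
  by have [_] := Hg n.+1; rewrite fn.
elim=> [|n IHn] /=; first by case: (NP 1).
have [_ _ finN _] := NP (f n).
apply: (@sub_finite_set _ _ [set C `&` D |
    C in [set left_coset a (H n) | a in Stab]
  & D in [set left_coset a (N (f n)) | a in Stab]]).
  move=> _ [a Sa <-]; exists (left_coset a (H n)); first by exists a.
  exists (left_coset a (N (f n))); first by exists a.
  by rewrite left_cosetI.
exact: finite_image2.
Qed.

Section Tree.
Variable H : nat -> set G.
Hypotheses (Hsub : forall n, is_subgroup (H n)) (HS : forall n, H n `<=` Stab)
  (Hdec : forall n, H n.+1 `<=` H n) (Htriv : forall g, (forall n, H n g) -> g = 1)
  (Hfin : forall n, finite_set [set left_coset a (H n) | a in Stab]).

(* The cosets of [H n] form level [n] of the trees hung on the orbit of [x0]; the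
   coset [g * H 0] is joined to [g x0] itself. *)
Definition is_level_coset (p : nat * set G) : bool :=
  `[< exists g, p.2 = left_coset g (H p.1) >].
Definition level_coset : choiceType := {p | is_level_coset p}.

Lemma lcoset_subproof n g : is_level_coset (n, left_coset g (H n)).
Proof. by apply/asboolP; exists g. Qed.

Definition lcoset n g : level_coset :=
  exist (fun p => is_level_coset p) _ (lcoset_subproof n g).

Lemma lcoset_eqP n g h : lcoset n g = lcoset n h <-> exists2 k, H n k & h = g * k.
Proof.
rewrite -(left_coset_eqP (Hsub n)); split=> [/(congr1 val)[]//|e].
by apply: val_inj; rewrite /= e.
Qed.

Definition level (c : level_coset) : nat := (val c).1.

Lemma level_cosetP c : exists g, c = lcoset (level c) g.
Proof.
case: c => -[n C] nC; have /asboolP[g /= gC] := nC; exists g.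
by apply: val_inj; apply: (congr1 (pair n) gC).
Qed.

Definition lrepr c : G := projT1 (cid (level_cosetP c)).

Lemma lreprK c : lcoset (level c) (lrepr c) = c.
Proof. by rewrite /lrepr; case: cid => /= g <-. Qed.

Definition blow_up : choiceType := (V + level_coset)%type.

Definition base_point c : V := act (lrepr c) x0.

(** The parent of [c], computed from a chosen representative; [up0] and [upS] remove the dependence
    on the choice. *)
Definition up c : blow_up :=
  if level c is n.+1 then inr (lcoset n (lrepr c)) else inl (base_point c).

Lemma lrepr_lcoset n g : exists2 k, H n k & lrepr (lcoset n g) = g * k.
Proof. by apply/lcoset_eqP; rewrite (lreprK (lcoset n g)). Qed.

Lemma base_pointE n g : base_point (lcoset n g) = act g x0.
Proof.
by rewrite /base_point; have [k /HS /= kS ->] := lrepr_lcoset n g; rewrite actM kS.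
Qed.

Lemma up0 g : up (lcoset 0 g) = inl (act g x0).
Proof. by rewrite /up /= base_pointE. Qed.

Lemma upS n g : up (lcoset n.+1 g) = inr (lcoset n g).
Proof.
rewrite /up /=; congr inr; apply/esym/lcoset_eqP.
by have [k /Hdec Hk ->] := lrepr_lcoset n.+1 g; exists k.
Qed.

Definition blow_up_adj : rel blow_up := fun x y =>
  match x, y with
  | inl v, inl w => adj v w
  | inl _, inr d => up d == x
  | inr c, inl _ => up c == y
  | inr c, inr d => (up c == y) || (up d == x)
  end.

Definition blow_up_act (g : G) (x : blow_up) : blow_up :=
  match x with
  | inl v => inl (act g v)
  | inr c => inr (lcoset (level c) (g * lrepr c))
  end.

Lemma blow_up_act_lcoset g n h :
  blow_up_act g (inr (lcoset n h)) = inr (lcoset n (g * h)).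
Proof.
rewrite /=; congr inr; apply/esym/lcoset_eqP.
by have [k Hk ->] := lrepr_lcoset n h; exists k; rewrite ?mulgA.
Qed.

Lemma blow_up_act1 x : blow_up_act 1 x = x.
Proof. by case: x => [v|c] /=; rewrite ?act1 ?mul1g ?lreprK. Qed.

Lemma blow_up_actM g h x :
  blow_up_act (g * h) x = blow_up_act g (blow_up_act h x).
Proof.
case: x => [v|c]; first by rewrite /= actM.
by rewrite -(lreprK c) !blow_up_act_lcoset mulgA.
Qed.

Lemma up_act g c d : blow_up_act g (inr c) = inr d -> up d = blow_up_act g (up c).
Proof.
rewrite -(lreprK c) blow_up_act_lcoset => -[<-].
by case: (level c) => [|n]; rewrite ?up0 ?upS ?blow_up_act_lcoset //= actM.
Qed.

Lemma blow_up_adj_act g x y :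
  blow_up_adj (blow_up_act g x) (blow_up_act g y) = blow_up_adj x y.
Proof.
have inj : injective (blow_up_act g) := gact_inj blow_up_act1 blow_up_actM (g := g).
have upE c : up (lcoset (level c) (g * lrepr c)) = blow_up_act g (up c).
  exact: up_act.
case: x y => [v|c] [w|d] /=; rewrite ?act_adj ?upE //.
- exact: (inj_eq inj (up d) (inl v)).
- exact: (inj_eq inj (up c) (inl w)).
- congr (_ || _); first exact: (inj_eq inj (up c) (inr d)).
  exact: (inj_eq inj (up d) (inr c)).
Qed.

(** Collapses each hung tree to its base point. Being equivariant, it brings a fixed pair of the
    blow-up back to the original tree. *)
Definition retract (x : blow_up) : V :=
  match x with inl v => v | inr c => base_point c end.

Lemma retract_act g x : retract (blow_up_act g x) = act g (retract x).
Proof. by case: x => [v|c] //=; rewrite base_pointE actM. Qed.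

Lemma retract_up c : retract (up c) = base_point c.
Proof.
rewrite -(lreprK c) base_pointE.
by case: (level c) => [|n]; rewrite ?up0 ?upS //= base_pointE.
Qed.

Lemma retract_adj x y :
  blow_up_adj x y -> retract x = retract y \/ adj (retract x) (retract y).
Proof.
case: x y => [v|c] [w|d] /=; first by right.
- by move=> /eqP/(congr1 retract); rewrite retract_up /=; left.
- by move=> /eqP/(congr1 retract); rewrite retract_up /=; left.
by move=> /orP[] /eqP/(congr1 retract); rewrite retract_up /=; left.
Qed.

Lemma blow_up_tree : is_tree blow_up_adj.
Proof.
have [[r] _ _ _ _] := tadj.
have [h [[sadj iadj low uniqlow] _ _]] := is_tree_height r tadj.
(* With this height, [up c] is the only neighbour of [c] that is not above it. *)
pose hW (x : blow_up) : nat :=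
  match x with inl v => h v | inr c => h (base_point c) + (level c).+1 end.
have hup c : hW (up c) < hW (inr c).
  rewrite -(lreprK c); case: (level c) => [|n]; rewrite ?up0 ?upS /= !base_pointE.
    by rewrite addn1.
  by rewrite /level /= [(_ + _.+2)%N]addnS ltnS.
have adjup c y : blow_up_adj (inr c) y -> hW y <= hW (inr c) -> y = up c.
  case: y => [w /eqP -> //|d /orP[/eqP -> //|/eqP upd]].
  by have := hup d; rewrite upd ltnNge => /negbTE ->.
apply: (@rooted_height_tree _ _ (inl r) hW); split.
- by case=> [v|c] [w|d] //=; rewrite orbC.
- case=> [v|c] /=; first exact: iadj.
  by apply/negP; rewrite orbb => /eqP upc; have := hup c; rewrite upc ltnn.
- case=> [v vr|c _].
    have [w vw hw] : exists2 w, adj v w & h w < h v.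
      by apply: low => e; apply: vr; rewrite e.
    by exists (inl w).
  exists (up c) => //; rewrite /blow_up_adj.
  by case: (up c) (eqxx (up c)) => // d ->.
case=> [v|c] y y'; last by move=> cy cy' /(adjup _ _ cy) -> /(adjup _ _ cy') ->.
have adjinl z : blow_up_adj (inl v) z -> hW z <= hW (inl v) ->
    exists2 w, z = inl w & adj v w /\ h w <= h v.
  case: z => [w|d]; first by exists w.
  by move=> /eqP upd; have := hup d; rewrite upd ltnNge => /negbTE ->.
move=> vy vy' /(adjinl _ vy)[w -> [vw hw]] /(adjinl _ vy')[w' -> [vw' hw']].
by rewrite (uniqlow v w w').
Qed.

Lemma blow_up_locally_finite : locally_finite blow_up_adj.
Proof.
have fin n g : finite_set [set lcoset n (g * a) | a in Stab].
  apply: (finite_factor (Hfin n)) => a b _ _ /(left_coset_eqP (Hsub n))[k Hk ->].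
  by apply/lcoset_eqP; exists k; rewrite ?mulgA.
(* All children of [x] are on one level and differ from a given child [lcoset n0 g0] by an element
   of [Stab], so finite index bounds their number. *)
have finup x : finite_set [set d | up d = x].
  have [[n0 [g0 u0]]|nd] := pselect (exists n g, up (lcoset n g) = x); last first.
    rewrite (_ : [set _ | _] = set0); first exact: finite_set0.
    apply/seteqP; split=> // d upd; case: nd.
    by exists (level d), (lrepr d); rewrite lreprK.
  apply: (sub_finite_set _ (fin n0 g0)) => d /=; rewrite -u0 -(lreprK d) {u0}.
  move: (level d) (lrepr d) => n g {d}.
  case: n n0 => [|n] [|m]; rewrite ?up0 ?upS // => -[].
    move=> e; exists (g0^-1 * g); last by rewrite mulVKg.
    by rewrite /stabilizer /= actM e -actM mulVg act1.
  move=> nm; rewrite {}nm => e; have /esym/lcoset_eqP[k /HS Sk ->] :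
    lcoset m g = lcoset m g0 by apply: val_inj; rewrite /= e.
  by exists k.
case=> [v|c].
  apply: (@sub_finite_set _ _ (inl @` [set w | adj v w]
      `|` inr @` [set d | up d = inl v])).
    by case=> [w|d] /=; [left; exists w|move=> /eqP; right; exists d].
  by rewrite finite_setU; split; apply: finite_image.
apply: (@sub_finite_set _ _ ([set up c] `|` inr @` [set d | up d = inr c])).
  case=> [w|d] /=; first by move=> /eqP <-; left.
  by move=> /orP[/eqP <-|/eqP cd]; [left|right; exists d].
by rewrite finite_setU; split=> //; apply: finite_image.
Qed.

Lemma blow_up_faithful : faithful_action blow_up_act.
Proof.
move=> g gfix; apply: Htriv => n.
have := gfix (inr (lcoset n 1)); rewrite blow_up_act_lcoset mulg1.
move=> /(congr1 (fun x => if x is inr c then c else lcoset n 1)).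
by move=> /esym/lcoset_eqP[k Hk ->]; rewrite mul1g.
Qed.

Lemma blow_up_nofix : ~ fixed_pair blow_up_adj blow_up_act.
Proof.
move=> [x [y [xy fixxy]]]; apply: nofix; exists (retract x), (retract y).
split; first by case: xy => [->|/retract_adj //]; left.
by move=> g; rewrite -!retract_act; case: (fixxy g) => -[-> ->]; [left|right].
Qed.

End Tree.

Lemma faithful_blow_up :
  exists (W : choiceType) (adjW : rel W) (actW : G -> W -> W),
    [/\ is_tree adjW, locally_finite adjW, is_simplicial_action adjW actW,
        faithful_action actW & ~ has_global_fixed_point adjW actW].
Proof.
have [H [Hsub HS Hdec Htriv Hfin]] := stabilizer_chain.
exists (blow_up H), (@blow_up_adj H), (@blow_up_act H); split.
- exact: blow_up_tree.
- exact: blow_up_locally_finite.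
- split; [exact: blow_up_act1|exact: blow_up_actM|exact: blow_up_adj_act].
- exact: blow_up_faithful.
rewrite global_fixed_pairP; first exact: blow_up_nofix.
  exact: blow_up_act1.
exact: blow_up_actM.
Qed.

End BlowUp.

Lemma mult_range_subgroup (G K : groupType) (f : {multiplicative G -> K}) :
  is_subgroup (range f).
Proof.
split; first by exists 1; rewrite ?mult1.
  by move=> _ _ [x _ <-] [y _ <-]; exists (x * y); rewrite ?multM.
by move=> _ [x _ <-]; exists x^-1; rewrite ?multV.
Qed.

(** * From a graph of groups to a faithful action *)

Section Backward.
Variables (A : finite_graph_of_groups) (T : {set gg_edge A}).
Local Notation Gam := (fundamental_group T).
Local Notation vE := (vertex_elt T).
Local Notation eE := (edge_elt T).
Hypothesis fin_edge : forall e : gg_edge A,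
  finite_index (range (src_mono e)) /\ finite_index (range (tgt_mono e)).

(** The edges of a given type and direction at a vertex correspond to the cosets of the edge group
    in the vertex group. *)
Lemma bs_locally_finite : locally_finite (@bs_adj A T).
Proof.
move=> x.
pose out e := [set bs_coset (gg_tgt e) (k * eE e) | k in
  [set k : Gam | bs_coset (gg_src e) k = x]].
pose inn e := [set bs_coset (gg_src e) k | k in
  [set k : Gam | bs_coset (gg_tgt e) (k * eE e) = x]].
apply: (@sub_finite_set _ _ (\bigcup_(e in [set: gg_edge A]) (out e `|` inn e))).
  move=> y /asboolP[e [g /= [[xE yE]|[xE yE]]]]; exists e => //.
    by left; exists g.
  by right; exists g.
apply: bigcup_finite => [|e _]; first exact: finite_finset.
have [fs ft] := fin_edge e; rewrite finite_setU; split.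
  have [[k0 k0x]|nk] := pselect (exists k : Gam, bs_coset (gg_src e) k = x);
    last first.
    rewrite (_ : out e = set0); first exact: finite_set0.
    by apply/seteqP; split=> // y [k kx _]; case: nk; exists k.
  apply: (@sub_finite_set _ _ [set bs_coset (gg_tgt e) (k0 * vE h * eE e) |
      h in [set: vertex_group (gg_src e)]]).
    move=> _ [k + <-] /=; rewrite -k0x => /esym/bs_coset_eqP[h ->].
    by exists h.
  apply: (finite_factor fs) => h h' _ _.
  move=> /(left_coset_eqP (mult_range_subgroup _))[_ [c _ <-] ->].
  apply/bs_coset_eqP; exists (tgt_mono e c).
  by rewrite vertex_eltM -!mulgA edge_eltP.
have [[k0 k0x]|nk] := pselect (exists k, bs_coset (gg_tgt e) (k * eE e) = x);
  last first.
  rewrite (_ : inn e = set0); first exact: finite_set0.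
  by apply/seteqP; split=> // y [k kx _]; case: nk; exists k.
apply: (@sub_finite_set _ _ [set bs_coset (gg_src e) (k0 * eE e * vE h * (eE e)^-1) |
    h in [set: vertex_group (gg_tgt e)]]).
  move=> _ [k + <-] /=; rewrite -k0x => /esym/bs_coset_eqP[h kE].
  by exists h => //; rewrite -kE mulgK.
apply: (finite_factor ft) => h h' _ _.
move=> /(left_coset_eqP (mult_range_subgroup _))[_ [c _ <-] ->].
apply/bs_coset_eqP; exists (src_mono e c).
rewrite vertex_eltM -!mulgA; congr (_ * (_ * (_ * _))).
by apply: (mulIg (eE e)); rewrite -!mulgA mulVg mulg1 edge_eltP mulKg.
Qed.

Hypotheses (sT : spanning_tree T) (G : groupType) (phi : {multiplicative G -> Gam})
  (phi_bij : bijective phi) (Gfg : finitely_generated G)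
  (nofix : ~ has_global_fixed_point (@bs_adj A T) (fun g : G => bs_act (phi g)))
  (rf : forall v : gg_vertex A, residually_finite (vertex_group v)).

Lemma graph_of_groups_faithful_action :
  exists (V : choiceType) (adj : rel V) (act : G -> V -> V),
    [/\ is_tree adj, locally_finite adj, is_simplicial_action adj act,
        faithful_action act & ~ has_global_fixed_point adj act].
Proof.
have act1 x : bs_act (phi 1) x = x by rewrite mult1 bs_act1.
have actM g h x : bs_act (phi (g * h)) x = bs_act (phi g) (bs_act (phi h) x).
  by rewrite multM bs_actM.
have /card_gt0P[v _] := gg_nonempty A.
pose x0 : bs_vertex T := bs_coset v 1.
have stabP h : bs_act (phi h) x0 = x0 -> exists k : vertex_group v, vE k = phi h.
  rewrite bs_act_coset mulg1 => /esym/bs_coset_eqP[k ->].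
  by exists k; rewrite mul1g.
apply: (@faithful_blow_up G _ (@bs_adj A T) (fun g => bs_act (phi g)) _ _ _ _ _ x0).
- exact: finitely_generated_enum.
- exact: bs_tree.
- exact: bs_locally_finite.
- by split=> // g x y; apply: bs_adj_act.
- by move=> fp; apply: nofix; apply/global_fixed_pairP.
move=> h Sh h1; have [k kh] := stabP h Sh.
have [|F [f fk1]] := @rf v k.
  move=> k1; apply: h1; apply: (bij_inj phi_bij).
  by rewrite -kh k1 vertex_elt1 mult1.
(* The kernel of [f], pulled back to [G] along [phi]. *)
pose N := [set g | exists2 l : vertex_group v, vE l = phi g & f l = 1].
have Nsub : is_subgroup N.
  split; first by exists 1; rewrite ?vertex_elt1 ?mult1.
    move=> a b [l la fl] [m mb fm]; exists (l * m).
      by rewrite vertex_eltM la mb multM.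
    by rewrite gmulfM fl fm mulg1.
  move=> a [l la fl]; exists l^-1; first by rewrite vertex_eltV la multV.
  by rewrite multV fl invg1.
exists N; split=> //.
- move=> a [l la _]; rewrite /stabilizer /= bs_act_coset mulg1 -la.
  apply/esym/bs_coset_eqP.
  by exists l; rewrite mul1g.
- move=> [l]; rewrite -kh => /(vertex_elt_inj sT) ->; exact: fk1.
(* [f] extended to [G], by 1 off the stabilizer. Its values lie in a finite group and determine the
   cosets of [N] in the stabilizer. *)
have [q qE] : exists q : G -> F, forall a l, vE l = phi a -> q a = f l.
  have exq a : exists c, forall l, vE l = phi a -> c = f l.
    have [[l la]|nl] := pselect (exists l : vertex_group v, vE l = phi a).
      by exists (f l) => m; rewrite -la => /(vertex_elt_inj sT) ->.
    by exists 1 => l la; case: nl; exists l.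
  by have [q qE] := choice exq; exists q.
apply: (@finite_factor _ _ _ _ q); first exact: finite_finset.
move=> a b /stabP[l la] /stabP[m mb]; rewrite (qE _ _ la) (qE _ _ mb) => flm.
apply/(left_coset_eqP Nsub); exists (a^-1 * b); last by rewrite mulVKg.
exists (l^-1 * m); first by rewrite vertex_eltM vertex_eltV la mb multM multV.
by apply: (mulgI (f l)); rewrite -gmulfM mulVKg mulg1.
Qed.

End Backward.

(** * Barycentric subdivision *)

Lemma set2_eq (T : Type) (x y a b : T) :
  [set x; y] = [set a; b] -> (x = a /\ y = b) \/ (x = b /\ y = a).
Proof.
move=> e.
have xab : [set a; b] x by rewrite -e; left.
have yab : [set a; b] y by rewrite -e; right.
have axy : [set x; y] a by rewrite e; left.
have bxy : [set x; y] b by rewrite e; right.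
case: xab yab axy bxy => /= xE [] /= yE [] /= aE [] /= bE; subst; tauto.
Qed.

(** Ends of walks from [a] along which [l] rises by one at each step; the last step stays visible,
    to detect backtracking. *)
Inductive ascending (B : Type) (badj : rel B) (l : B -> nat) (a : B) : B -> Prop :=
| ascending_start : ascending badj l a a
| ascending_step x y of ascending badj l a x & badj x y & l y = (l x).+1 :
    ascending badj l a y.

(* Rooting the tree at [F a], a walk leaving [a] without backtracking moves away
   from the root. *)
Lemma locally_injective_tree (B V : choiceType) (badj : rel B) (adj : rel V)
    (F : B -> V) :
  symmetric badj -> (forall x y, reach badj x y) -> is_tree adj ->
  (forall x y, badj x y -> adj (F x) (F y)) ->
  (forall x y y', badj x y -> badj x y' -> F y = F y' -> y = y') ->
  injective F.
Proof.
move=> sb conn tadj Fadj Floc a b Fab.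
have [h [[_ _ _ uniqlow] hr hdiff]] := is_tree_height (F a) tadj.
suff ascb : ascending badj (h \o F) a b.
  by case: ascb Fab => //= x y _ _ + Fab; rewrite -Fab hr.
apply: (@reach_ind_set _ badj (ascending badj (h \o F) a) a b _ _ (conn a b));
  last exact: ascending_start.
move=> x y ascx xy; have [hxy|hyx] := hdiff _ _ (Fadj _ _ xy); last first.
  exact: ascending_step xy _.
case: {x} ascx xy hxy => [|z x ascz zx /= hx] xy hxy; first by rewrite hr in hxy.
(* A descent from [x] must go back to its predecessor [z]: both images are the parent of [F x], and
   [F] is injective on the neighbours of [x]. *)
suff <- : z = y by [].
have xz : badj x z by rewrite sb.
apply: (Floc x) => //; apply: (uniqlow (F x)); [exact: Fadj|exact: Fadj| |].
  by rewrite hx.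
by rewrite hxy.
Qed.

(** * Residual finiteness of vertex stabilizers *)

Section Residual.
Variables (G : groupType) (V : choiceType) (adj : rel V) (act : G -> V -> V).
Hypotheses (act1 : forall x, act 1 x = x)
  (actM : forall g h x, act (g * h) x = act g (act h x))
  (act_adj : forall g x y, adj (act g x) (act g y) = adj x y)
  (tadj : is_tree adj) (fadj : locally_finite adj)
  (faith : faithful_action act).

(** Along a path from [x], each orbit lies among the neighbours of the preceding finite orbit. *)
Lemma stabilizer_orbit_finite x z :
  finite_set [set act g z | g in stabilizer act x].
Proof.
have [_ _ _ conn _] := tadj.
apply: (@reach_ind_set _ adj (fun z =>
  finite_set [set act g z | g in stabilizer act x]) x z _ _ (conn x z)).
  move=> a b fina ab.
  apply: (@sub_finite_set _ _ (\bigcup_(y in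
      [set act g a | g in stabilizer act x]) [set w | adj y w])).
    move=> _ [g gx <-]; exists (act g a); first by exists g.
    by rewrite /= act_adj.
  by apply: bigcup_finite => // y _; apply: fadj.
by apply: (@sub_finite_set _ _ [set x]) => // _ [g gx <-].
Qed.

Local Notation stab_type x :=
  (subgroup_type (stabilizer_subgroup act1 actM x)).

Lemma stabilizer_residually_finite x :
  residually_finite (stab_type x).
Proof.
move=> g g1.
have [z gz] : exists z, act (hval g) z <> z.
  apply: contrapT => nz; apply: g1; apply: hval_inj; apply: faith => z.
  by apply: contrapT => gz; apply: nz; exists z.
have [s sE] := (finite_seqP _).1 (stabilizer_orbit_finite x z).
have sP y : (y \in s) = [set act g z | g in stabilizer act x] y :> Prop.
  by rewrite sE.
have inS (k : stab_type x) (y : seq_sub s) : act (hval k)^-1 (ssval y) \in s.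
  have := ssvalP y; rewrite !sP => -[l lx <-].
  exists ((hval k)^-1 * l); last by rewrite actM.
  have [_ SM SV] := stabilizer_subgroup act1 actM x.
  by apply: SM => //; apply: SV; exact: (hvalP k).
(* Permutations compose from left to right, so the action by inverses gives a homomorphism. *)
pose m (k : stab_type x) (y : seq_sub s) : seq_sub s := SeqSub (inS k y).
have minj k : injective (m k).
  by move=> y y' /(congr1 (@ssval _ _)) /(gact_inj act1 actM) yy'; apply: val_inj.
pose f (k : stab_type x) : {perm seq_sub s} := perm (minj k).
have fM : {morph f : k l / k * l}.
  move=> k l; apply/permP => y; rewrite permM !permE; apply: val_inj.
  by rewrite -[LHS]/(act (hval (k * l))^-1 (ssval y)) hvalM invgM actM.
exists {perm seq_sub s}, (pack_mult fM) => fg.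
have zs : z \in s by rewrite sP; exists 1; [exact: act1|exact: act1].
apply: gz; have := congr1 (fun p : {perm seq_sub s} => ssval (p (SeqSub zs))) fg.
rewrite /= permE perm1 /= => e; rewrite -{1}e -actM mulgV; exact: act1.
Qed.

End Residual.

(** * The action on the subdivided tree *)

Section Subdivision.
Variables (G : groupType) (V : choiceType) (adj : rel V) (act : G -> V -> V).
Hypotheses (act1 : forall x, act 1 x = x)
  (actM : forall g h x, act (g * h) x = act g (act h x))
  (act_adj : forall g x y, adj (act g x) (act g y) = adj x y).

(** Edges are unordered sets, so that flipping an edge fixes its midpoint. *)
Definition is_edge (E : set V) : bool :=
  `[< exists x y, adj x y /\ E = [set x; y] >].
Definition undirected_edge : choiceType := {E | is_edge E}.
Definition subdivision : choiceType := (V + undirected_edge)%type.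
Implicit Types E : undirected_edge.

Lemma undirected_edgeP E : exists x y, adj x y /\ val E = [set x; y].
Proof. by case: E => E /= /asboolP. Qed.

Lemma is_edge_set2 x y : adj x y -> is_edge [set x; y].
Proof. by move=> xy; apply/asboolP; exists x, y. Qed.

Definition set2_edge x y (xy : adj x y) : undirected_edge :=
  exist (fun C => is_edge C) _ (is_edge_set2 xy).

Definition subdivision_adj : rel subdivision := fun a b =>
  match a, b with
  | inl x, inr E | inr E, inl x => `[< val E x >]
  | _, _ => false
  end.

Lemma is_edge_act g E : is_edge (act g @` val E).
Proof.
have [x [y [xy ->]]] := undirected_edgeP E; apply/asboolP.
by exists (act g x), (act g y); rewrite act_adj image_setU !image_set1.
Qed.

Definition subdivision_act (g : G) (a : subdivision) : subdivision :=
  match a with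
  | inl x => inl (act g x)
  | inr E => inr (exist (fun C => is_edge C) _ (is_edge_act g E))
  end.

(* Edges of the subdivision are oriented from original vertices to midpoints. *)
Definition is_original (a : subdivision) : bool := if a is inl _ then true else false.

Lemma subdivision_act1 a : subdivision_act 1 a = a.
Proof.
case: a => [x|E] /=; first by rewrite act1.
congr inr; apply: val_inj => /=; rewrite (_ : act 1 = id) ?image_id //.
exact/funext.
Qed.

Lemma subdivision_actM g h a :
  subdivision_act (g * h) a = subdivision_act g (subdivision_act h a).
Proof.
case: a => [x|E] /=; first by rewrite actM.
congr inr; apply: val_inj => /=; rewrite image_comp.
by congr (_ @` _); apply/funext => x; rewrite /= actM.
Qed.

Lemma subdivision_act_adj g a b :
  subdivision_adj (subdivision_act g a) (subdivision_act g b) =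
  subdivision_adj a b.
Proof.
have memE E x : `[< (act g @` val E) (act g x) >] = `[< val E x >].
  apply/asboolP/asboolP => [[y Sy /(gact_inj act1 actM) <-] //|Sx].
  by exists x.
by case: a b => [x|E] [y|E'] //=; apply: memE.
Qed.

Lemma subdivision_faithful : faithful_action act -> faithful_action subdivision_act.
Proof. by move=> faith g gfix; apply: faith => x; have [] := gfix (inl x). Qed.

Lemma subdivision_original_act g a : is_original (subdivision_act g a) = is_original a.
Proof. by case: a. Qed.

Lemma subdivision_original_adj a b :
  subdivision_adj a b -> is_original a = ~~ is_original b.
Proof. by case: a b => [x|E] [y|E']. Qed.

Lemma subdivision_fixed_pair :
  fixed_pair subdivision_adj subdivision_act -> fixed_pair adj act.
Proof.
move=> [a [b [ab fix_ab]]].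
have single x : (forall g, act g x = x) -> fixed_pair adj act.
  by move=> fx; exists x, x; split=> [|g]; left.
case: a b ab fix_ab => [x|E] [y|E'] ab fix_ab.
- case: ab => // -[xy]; apply: (single x) => g.
  by case: (fix_ab g) => -[[->]].
- by apply: (single x) => g; case: (fix_ab g) => [[[->]]|[]].
- by apply: (single y) => g; case: (fix_ab g) => [[_ [->]]|[]].
case: ab => // -[SS']; have [x [y [xy Sxy]]] := undirected_edgeP E.
exists x, y; split; first by right.
move=> g; have /(congr1 (fun a => if a is inr E then val E else set0)) /= :
    subdivision_act g (inr E) = inr E.
  by case: (fix_ab g) => -[-> _] //; rewrite SS'.
rewrite Sxy image_setU !image_set1 => gxy; exact: set2_eq.
Qed.

Hypotheses (tadj : is_tree adj) (fadj : locally_finite adj).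

Lemma subdivision_tree : is_tree subdivision_adj.
Proof.
have [[r] _ _ _ _] := tadj.
have [h [[sadj iadj low uniqlow] _ hdiff]] := is_tree_height r tadj.
have [hs hsE] : exists hs : undirected_edge -> nat,
    forall E x y, val E = [set x; y] -> hs E = (h x + h y)%N.
  suff ex E : exists n, forall x y, val E = [set x; y] -> n = (h x + h y)%N.
    by have [hs hsE] := choice ex; exists hs.
  have [x [y [xy ->]]] := undirected_edgeP E; exists (h x + h y)%N => a b.
  by move=> abE; case: (set2_eq abE) => -[-> ->] //; rewrite addnC.
(* Twice the height in the original tree, extended to midpoints by the mean of the ends. *)
pose hh (a : subdivision) := match a with inl x => (h x + h x)%N | inr E => hs E end.
have nbr E x : val E x -> exists2 y, adj x y & val E = [set x; y].
  have [a [b [ab SE]]] := undirected_edgeP E; rewrite SE => -[|] /= ->.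
    by exists b.
  by exists a; [rewrite sadj|rewrite setUC].
apply: (@rooted_height_tree _ _ (inl r) hh); split.
- by case=> [x|E] [y|E'].
- by case.
- case=> [x xr|E _].
    have [y xy hy] : exists2 y, adj x y & h y < h x.
      by apply: low => e; apply: xr; rewrite e.
    exists (inr (set2_edge xy)); first by apply/asboolP; left.
    by rewrite /= (hsE _ x y) // ltn_add2l.
  have [x [y [xy SE]]] := undirected_edgeP E.
  case: (hdiff _ _ xy) => hxy.
    exists (inl y); first by apply/asboolP; rewrite SE; right.
    by rewrite /= (hsE _ _ _ SE) hxy ltn_add2r.
  exists (inl x); first by apply/asboolP; rewrite SE; left.
  by rewrite /= (hsE _ _ _ SE) hxy ltn_add2l.
case=> [x|E] [y|E1] [y'|E2] //= /asboolP m1 /asboolP m2.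
  have [y1 xy1 SE1] := nbr _ _ m1; have [y2 xy2 SE2] := nbr _ _ m2.
  rewrite (hsE _ _ _ SE1) (hsE _ _ _ SE2) !leq_add2l => h1 h2.
  by congr inr; apply: val_inj; rewrite SE1 SE2 (uniqlow x y1 y2).
have [a ya SE] := nbr _ _ m1; rewrite (hsE _ _ _ SE) => h1 h2; congr inl.
have : [set y; a] y' by rewrite -SE.
move=> [-> //|y'a]; rewrite /= in y'a; rewrite y'a in h2.
rewrite leq_add2l in h1; rewrite leq_add2r in h2.
by case: (hdiff _ _ ya) => e; rewrite e ltnn in h1 h2.
Qed.

Lemma subdivision_locally_finite : locally_finite subdivision_adj.
Proof.
have [_ sadj _ _ _] := tadj.
case=> [x|E].
  apply: (@sub_finite_set _ _ (inr @` [set E : undirected_edge | val E x])).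
    by case=> // E /asboolP Sx; exists E.
  apply: finite_image; rewrite -[X in finite_set X]image_id.
  apply: (@finite_factor _ _ _ _ (fun E : undirected_edge => val E)); last first.
    by move=> E E' _ _; apply: val_inj.
  apply: (@sub_finite_set _ _ [set [set x; y] | y in [set y | adj x y]]).
    move=> _ [E Sx <-] /=; have [a [b [ab SE]]] := undirected_edgeP E.
    move: Sx; rewrite /= SE => -[|] /= ->; first by exists b.
    by exists a; [rewrite /= sadj|rewrite setUC].
  exact/finite_image/fadj.
have [x [y [_ SE]]] := undirected_edgeP E.
apply: (@sub_finite_set _ _ (inl @` [set x; y])).
  by case=> // z /asboolP; rewrite SE => Sz; exists z.
exact/finite_image/finite_set2.
Qed.

End Subdivision.

(** * Fundamental domains *)

(** The colour fixes the direction of each edge; a colour-preserving action then never inverts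
    one. *)
Definition oriented_edge (V : choiceType) (adj : rel V) (col : V -> bool)
    (P : set V) (q : V * V) : Prop :=
  [/\ adj q.1 q.2, col q.1, P q.1 & P q.2].

Section FundamentalDomain.
Variables (G : groupType) (V : choiceType) (adj : rel V) (act : G -> V -> V).
Hypotheses (act1 : forall x, act 1 x = x)
  (actM : forall g h x, act (g * h) x = act g (act h x))
  (act_adj : forall g x y, adj (act g x) (act g y) = adj x y)
  (fadj : locally_finite adj).
Variables (b0 : V) (h : V -> nat).
Hypotheses (rh : rooted_height adj b0 h) (h0 : h b0 = 0%N)
  (hdiff : forall x y, adj x y -> h x = (h y).+1 \/ h y = (h x).+1).

Let sadj : symmetric adj. Proof. by case: rh. Qed.
Let lower x : x <> b0 -> exists2 y, adj x y & h y < h x.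
Proof. by case: rh => _ _ + _; apply. Qed.
Let uniq_lower x y y' :
  adj x y -> adj x y' -> h y <= h x -> h y' <= h x -> y = y'.
Proof. by case: rh => _ _ _; apply. Qed.

Lemma ball_finite n : finite_set [set x | h x <= n].
Proof.
elim: n => [|n IHn].
  apply: (@sub_finite_set _ _ [set b0]) => // x /= hx.
  apply: contrapT => /lower[y _]; rewrite ltnNge.
  by rewrite (leq_trans hx).
apply: (@sub_finite_set _ _ ([set b0] `|`
    \bigcup_(y in [set x | h x <= n]) [set z | adj y z])).
  move=> x /= hx; have [->|/eqP xb] := eqVneq x b0; first by left.
  have [y xy hy] := lower xb; right; exists y; last by rewrite /= sadj.
  by rewrite /= -ltnS; apply: leq_trans hx.
rewrite finite_setU; split=> //; apply: bigcup_finite => // y _; exact: fadj.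
Qed.

Definition orbit_ball n : set V := [set z | exists g, h (act g z) <= n].

Lemma orbit_ball_act n g z : orbit_ball n (act g z) <-> orbit_ball n z.
Proof.
split=> [[k kz]|[k kz]]; first by exists (k * g); rewrite actM.
by exists (k * g^-1); rewrite actM (gactK act1 actM).
Qed.

Lemma orbit_ball0 n : orbit_ball n b0.
Proof. by exists 1; rewrite act1 h0. Qed.

Definition adj_within (P : set V) : rel V :=
  fun a b => [&& adj a b, `[< P a >] & `[< P b >]].

Lemma adj_within_sym P : symmetric (adj_within P).
Proof. by move=> a b; rewrite /adj_within sadj [X in _ && X]andbC. Qed.

Lemma orbit_ball_connected : finitely_generated G ->
  exists n, forall p, orbit_ball n p -> reach (adj_within (orbit_ball n)) b0 p.
Proof.
(* Radius for which the ball contains the image of [b0] under each generator. *)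
move=> [s gens]; pose n := \max_(x <- s) h (act x b0); exists n.
set P := orbit_ball n.
have actr g a b : reach (adj_within P) a b -> reach (adj_within P) (act g a) (act g b).
  apply: (@reach_ind_set _ _ (fun b =>
    reach (adj_within P) (act g a) (act g b))); last exact: reach_refl.
  move=> c d ac /and3P[cd /asboolP Pc /asboolP Pd].
  apply: reach_trans ac (reach_edge _); apply/and3P; split.
  - by rewrite act_adj.
  - exact/asboolP/orbit_ball_act.
  - exact/asboolP/orbit_ball_act.
have ball m x : h x = m -> m <= n -> reach (adj_within P) b0 x.
  elim: m x => [|m IHm] x hx mn; have [->|/eqP xb] := eqVneq x b0;
    try exact: reach_refl; have [y xy hy] := lower xb; first by rewrite hx in hy.
  have hym : h y = m.
    by case: (hdiff xy) => e; [rewrite hx in e; case: e|rewrite e ltnNge leqnSn in hy].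
  apply: reach_trans (IHm y hym (ltnW mn)) (reach_edge _).
  apply/and3P; split; first by rewrite sadj.
    by apply/asboolP; exists 1; rewrite act1 hym ltnW.
  by apply/asboolP; exists 1; rewrite act1 hx.
have conn : forall g, reach (adj_within P) b0 (act g b0).
  apply: (generated_ind gens).
    split; first by rewrite act1; apply: reach_refl.
      by move=> x y rx ry; rewrite actM; apply: reach_trans rx (actr _ _ _ ry).
    move=> x rx; apply: (reach_sym (@adj_within_sym P)).
    by rewrite -[X in reach _ _ X]act1 -(mulVg x) actM; apply: actr.
  by move=> x xs; apply: (ball _ _ erefl); rewrite /n (big_rem x xs) /= leq_maxl.
move=> p [g gp]; apply: reach_trans (conn g^-1) _.
rewrite -[p](gactK act1 actM g); apply: actr; exact: (ball _ _ erefl).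
Qed.

Variable n : nat.
Local Notation P := (orbit_ball n).
Hypothesis Pconn : forall p, P p -> reach (adj_within P) b0 p.

(** Closure under parents makes [Y], once nonempty, a subtree through [b0]. *)
Definition transversal_tree (Y : set V) : Prop :=
  [/\ Y `<=` P, forall y z, Y y -> adj y z -> h z < h y -> Y z
    & forall y y' g, Y y -> Y y' -> act g y = y' -> y = y'].

Lemma exists_transversal_tree : exists Y : set V,
  [/\ transversal_tree Y, Y b0, finite_set Y
    & forall p, P p -> exists g, Y (act g p)].
Proof.
have [Y [[YP Ylow Yorb] Ymax]] : exists Y : set V,
    transversal_tree Y /\ forall B : set V, Y `<` B -> ~ transversal_tree B.
  apply: Zorn_bigcup => F Ftree Ftot; split.
  - by move=> y [Z FZ Zy]; have [ZP _ _] := Ftree _ FZ; apply: ZP.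
  - move=> y z [Z FZ Zy] yz hz; exists Z => //.
    by have [_ Zlow _] := Ftree _ FZ; apply: Zlow hz.
  move=> y y' g [Z FZ Zy] [Z' FZ' Zy'].
  have [ZZ'|Z'Z] := Ftot _ _ FZ FZ'.
    by have [_ _ Zorb] := Ftree _ FZ'; apply: Zorb => //; apply: ZZ'.
  by have [_ _ Zorb] := Ftree _ FZ; apply: Zorb => //; apply: Z'Z.
(* By maximality, no vertex whose parent is in [Y] has an orbit that misses [Y]. *)
have addY z : P z -> (forall w, adj z w -> h w < h z -> Y w) ->
    (forall g, ~ Y (act g z)) -> False.
  move=> Pz zlow zorb; apply: (Ymax (Y `|` [set z])).
    split; first by move=> y; left.
    by move=> /(_ z (or_intror erefl)); have := zorb 1; rewrite act1.
  split.
  - by move=> y [/YP //|->].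
  - move=> y w [Yy|->] yw hw; first by left; apply: Ylow hw.
    by left; apply: zlow.
  move=> y y' g [Yy|->] [Yy'|->] // gyy'; first exact: (Yorb _ _ g).
    by case: (zorb g^-1); rewrite -gyy' (gactK act1 actM).
  by case: (zorb g); rewrite gyy'.
(* The empty set is also a transversal tree; if [Y] were empty, [b0] could be added. *)
have Yb0 : Y b0.
  apply: contrapT => nb; have Y0 y : ~ Y y.
    move: {2}(h y) (leqnn (h y)) => m; elim: m y => [|m IHm] y hy Yy;
      have [yb|/eqP/lower[z yz hz]] := eqVneq y b0; try by apply: nb; rewrite -yb.
      by have := leq_trans hz hy.
    by apply: (IHm z); [rewrite -ltnS; apply: leq_trans hy|apply: Ylow hz].
  apply: (addY b0); [exact: orbit_ball0| |by move=> g /Y0].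
  by move=> w _; rewrite h0.
have cover p : P p -> exists g, Y (act g p).
  move=> Pp; apply: (@reach_ind_set _ (adj_within P) (fun p =>
    exists g, Y (act g p)) b0 p _ _ (Pconn Pp)); last by exists 1; rewrite act1.
  move=> a b [g Yga] /and3P[ab _ /asboolP Pb]; apply: contrapT => nb.
  have nY k : ~ Y (act k (act g b)) by rewrite -actM => Yk; apply: nb; exists (k * g).
  have gab : adj (act g a) (act g b) by rewrite act_adj.
  apply: (addY (act g b)) => //; first exact/orbit_ball_act.
  (* If [act g b] is the parent of [act g a], it is in [Y] already; otherwise [act g a] is its
     parent, hence equals [w]. *)
  move=> w gbw hw; have [hgab|hgba] := hdiff gab.
    case: (nY 1); rewrite act1; apply: (Ylow _ _ Yga gab).
    by rewrite hgab.
  suff <- : act g a = w by [].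
  apply: (@uniq_lower (act g b)) => //; first by rewrite sadj.
    by rewrite hgba.
  exact: ltnW.
exists Y; split=> //.
(* Each vertex of [Y] can be moved into the finite ball, and injectively, since [Y] meets each orbit
   at most once. *)
have [t tP] : exists t : V -> G, forall y, P y -> h (act (t y) y) <= n.
  have ext y : exists g, P y -> h (act g y) <= n.
    have [[g gy]|nP] := pselect (P y); first by exists g.
    by exists 1 => /nP.
  by have [t tP] := choice ext; exists t.
rewrite -[Y]image_id; apply: (@finite_factor _ _ _ _ (fun y => act (t y) y)).
  by apply: (sub_finite_set _ (ball_finite n)) => _ [y /YP Py <-]; apply: tP.
move=> y y' Yy Yy' e; apply: (Yorb _ _ ((t y')^-1 * t y)) => //.
by rewrite actM e (gactK act1 actM).
Qed.

Section EdgeRepresentatives.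
Variables (col : V -> bool) (Y : set V).
Hypotheses (colact : forall g x, col (act g x) = col x)
  (Yorb : forall y y' g, Y y -> Y y' -> act g y = y' -> y = y')
  (Yfin : finite_set Y) (Ycov : forall p, P p -> exists g, Y (act g p)).

Local Notation oriented_edge := (oriented_edge adj col P).

Definition act2 (g : G) (q : V * V) : V * V := (act g q.1, act g q.2).

Lemma act2_1 q : act2 1 q = q.
Proof. by case: q => a b; rewrite /act2 !act1. Qed.

Lemma act2M g k q : act2 (g * k) q = act2 g (act2 k q).
Proof. by rewrite /act2 !actM. Qed.

Lemma oriented_edge_act g q : oriented_edge q -> oriented_edge (act2 g q).
Proof.
move=> [q12 c1 P1 P2]; split; rewrite /= ?act_adj ?colact //; exact/orbit_ball_act.
Qed.

Lemma exists_edge_representatives : exists R : set (V * V),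
  [/\ finite_set R,
      forall r, R r -> oriented_edge r /\ Y r.1,
      forall q, oriented_edge q -> exists g r, R r /\ act2 g r = q,
      forall r r' g, R r -> R r' -> act2 g r = r' -> r = r'
    & forall y z, oriented_edge (y, z) -> Y y -> Y z -> R (y, z)].
Proof.
pose K q := [set r | (exists g, act2 g q = r) /\ Y r.1].
(* Both ends are taken in [Y] when possible, so that the edges of [Y] represent
   themselves. *)
pose best (K : set (V * V)) :=
  xget (b0, b0) (if `[< exists r, K r /\ Y r.2 >]
                 then [set r | K r /\ Y r.2] else K).
have K0 q : oriented_edge q -> exists r, K q r.
  move=> [_ _ P1 _]; have [g Yg] := Ycov P1.
  by exists (act2 g q); split=> //; exists g.
have bestP q : oriented_edge q -> K q (best (K q)).
  move=> /K0[r Kr]; rewrite /best; case: asboolP => [[r' Kr']|_].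
    by case: xgetP => [r'' _ []//|/(_ _ Kr')].
  by case: xgetP => [r'' _ //|/(_ _ Kr)].
(* The representative depends on [q] only through [K q], hence only on the orbit of [q]. *)
have Keq g q : K (act2 g q) = K q.
  apply/seteqP; split=> r [[k <-] Yk]; split=> //.
    by exists (k * g); rewrite act2M.
  by exists (k * g^-1); rewrite -act2M mulgVK.
exists [set best (K q) | q in oriented_edge]; split.
- apply: (@sub_finite_set _ _ (\bigcup_(y in Y) (pair y @` [set z | adj y z]))).
    move=> _ [q oq <-]; have [[g gq] Yr] := bestP _ oq.
    have [r12 _ _ _] := oriented_edge_act g oq; rewrite gq in r12.
    exists (best (K q)).1 => //; exists (best (K q)).2 => //.
    by rewrite -surjective_pairing.
  by apply: bigcup_finite => // y _; apply/finite_image/fadj.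
- move=> _ [q oq <-]; have [[g gq] Yr] := bestP _ oq; split=> //.
  by rewrite -gq; apply: oriented_edge_act.
- move=> q oq; have [[g gq] Yr] := bestP _ oq; exists g^-1, (best (K q)).
  by split; [exists q|rewrite -gq -act2M mulVg act2_1].
- move=> _ _ g [q oq <-] [q' oq' <-] e; congr best.
  have [[k kq] _] := bestP _ oq; have [[k' kq'] _] := bestP _ oq'.
  by rewrite -(Keq k' q') kq' -e -kq !Keq.
(* An edge in the orbit of [(y, z)] with both ends in [Y] is [(y, z)] itself, because [Y] meets each
   orbit at most once. *)
move=> y z oyz Yy Yz; exists (y, z) => //; rewrite /best.
have Kyz : [set r | K (y, z) r /\ Y r.2] (y, z).
  by split=> //; split=> //; exists 1; apply: act2_1.
case: asboolP => [_|nr]; last by case: nr; exists (y, z).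
case: xgetP => [[y' z'] _ [[[g []]] /= gy gz Yy' Yz']|/(_ _ Kyz) //].
by rewrite (Yorb Yy Yy' gy) (Yorb Yz Yz' gz).
Qed.

End EdgeRepresentatives.

End FundamentalDomain.

(** * The quotient graph of groups *)

Section QuotientGraphOfGroups.
Variables (G : groupType) (V : choiceType) (adj : rel V) (act : G -> V -> V).
Hypotheses (act1 : forall x, act 1 x = x)
  (actM : forall g h x, act (g * h) x = act g (act h x))
  (act_adj : forall g x y, adj (act g x) (act g y) = adj x y)
  (fadj : locally_finite adj) (tadj : is_tree adj).
Variables (b0 : V) (h : V -> nat) (col : V -> bool) (P : set V)
  (Y : seq V) (R : seq (V * V)) (rep : V -> V) (tr : V -> G).
Hypotheses (rh : rooted_height adj b0 h)
  (colact : forall g x, col (act g x) = col x)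
  (coladj : forall x y, adj x y -> col x = ~~ col y)
  (Pact : forall g x, P (act g x) <-> P x)
  (Pconn : forall p, P p -> reach (adj_within adj P) b0 p)
  (YP : forall y, y \in Y -> P y)
  (Ylow : forall y z, y \in Y -> adj y z -> h z < h y -> z \in Y)
  (Yorb : forall y y' g, y \in Y -> y' \in Y -> act g y = y' -> y = y')
  (Yb0 : b0 \in Y)
  (repY : forall p, P p -> rep p \in Y)
  (repK : forall p, P p -> act (tr p) (rep p) = p)
  (tr1 : forall y, y \in Y -> tr y = 1)
  (RP : forall r, r \in R -> oriented_edge adj col P r /\ r.1 \in Y)
  (Rcov : forall q, oriented_edge adj col P q ->
    exists g r, r \in R /\ act2 act g r = q)
  (Rorb : forall r r' g, r \in R -> r' \in R -> act2 act g r = r' -> r = r')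
  (RY : forall y z, oriented_edge adj col P (y, z) -> y \in Y -> z \in Y ->
    (y, z) \in R).

Definition qg_vertex : finType := seq_sub Y.
Definition qg_edge : finType := seq_sub R.
Implicit Types (v w : qg_vertex) (e : qg_edge).

Definition qg_src e : qg_vertex := SeqSub (RP (ssvalP e)).2.

Lemma edge_end_P e : P (ssval e).2.
Proof. by have [[_ _ _ P2] _] := RP (ssvalP e). Qed.

Lemma edge_adj e : adj (ssval e).1 (ssval e).2.
Proof. by have [[] ] := RP (ssvalP e). Qed.

Lemma edge_col e : col (ssval e).1 /\ col (ssval e).2 = false.
Proof.
have [[e12 c1 _ _] _] := RP (ssvalP e); split=> //.
by move: c1; rewrite (coladj e12) => /negbTE.
Qed.

Definition qg_tgt e : qg_vertex := SeqSub (repY (edge_end_P e)).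
(** The image in [G] of the letter of [e]; by [tr1] it is trivial on the spanning tree. *)
Definition qg_elt e : G := tr (ssval e).2.

Lemma qg_eltE e : act (qg_elt e) (ssval (qg_tgt e)) = (ssval e).2.
Proof. exact/repK/edge_end_P. Qed.

Lemma qg_eltVE e : act (qg_elt e)^-1 (ssval e).2 = ssval (qg_tgt e).
Proof. by rewrite -[in LHS]qg_eltE (gactK act1 actM). Qed.

Local Notation Stab x := (stabilizer_subgroup act1 actM x).

Definition qg_vertex_group v : groupType := subgroup_type (Stab (ssval v)).

Definition edge_stab_subgroup e :=
  is_subgroupI (Stab (ssval e).1) (Stab (ssval e).2).

Definition qg_edge_group e : groupType := subgroup_type (edge_stab_subgroup e).

Definition qg_src_fun e (c : qg_edge_group e) : qg_vertex_group (qg_src e) :=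
  hsub (Stab (ssval (qg_src e))) (hvalP c).1.

Lemma qg_tgt_subproof e (c : qg_edge_group e) :
  stabilizer act (ssval (qg_tgt e)) ((qg_elt e)^-1 * hval c * qg_elt e).
Proof.
by rewrite /stabilizer /= !actM qg_eltE (hvalP c).2 qg_eltVE.
Qed.

Definition qg_tgt_fun e (c : qg_edge_group e) : qg_vertex_group (qg_tgt e) :=
  hsub (Stab (ssval (qg_tgt e))) (qg_tgt_subproof c).

Lemma qg_src_funM e : {morph @qg_src_fun e : c d / c * d}.
Proof. by move=> c d; apply: hval_inj. Qed.

Lemma qg_tgt_funM e : {morph @qg_tgt_fun e : c d / c * d}.
Proof.
move=> c d; apply: hval_inj; rewrite hvalM /= !mulgA.
by rewrite mulgK.
Qed.

Definition qg_src_mono e := pack_mult (@qg_src_funM e).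
Definition qg_tgt_mono e := pack_mult (@qg_tgt_funM e).

Lemma qg_src_inj e : injective (qg_src_mono e).
Proof. by move=> c d /(congr1 (@hval _ _ _)) cd; apply: hval_inj. Qed.

Lemma qg_tgt_inj e : injective (qg_tgt_mono e).
Proof.
move=> c d /(congr1 (@hval _ _ _)) /= /mulIg/mulgI cd; exact: hval_inj.
Qed.

Definition qg_tree : {set qg_edge} := [set e | (ssval e).2 \in Y]%SET.

Lemma repid y : y \in Y -> rep y = y.
Proof. by move=> yY; have := repK (YP yY); rewrite (tr1 yY) act1. Qed.

Lemma qg_tree_tgt e : e \in qg_tree -> ssval (qg_tgt e) = (ssval e).2.
Proof. by rewrite inE /= => /repid. Qed.

Definition qg_tree_adj : rel qg_vertex := 
  [rel x y | [exists e in qg_tree, ((qg_src e == x) && (qg_tgt e == y))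
                          || ((qg_src e == y) && (qg_tgt e == x))]].

(** The spanning tree is the subtree induced on [Y], since by [RY] its edges represent themselves;
    the height [h] thus restricts to it. *)
Lemma qg_tree_adjE v w : qg_tree_adj v w = adj (ssval v) (ssval w).
Proof.
have [sadj _ _ _] := rh.
apply/existsP/idP => [[e /andP[eT]]|vw].
  have eadj : adj (ssval (qg_src e)) (ssval (qg_tgt e)).
    by rewrite qg_tree_tgt //; apply: edge_adj.
  by case/orP=> /andP[/eqP <- /eqP <-] //; rewrite sadj.
have ex x y : adj (ssval x) (ssval y) -> col (ssval x) -> exists e : qg_edge,
    [/\ e \in qg_tree, qg_src e = x & qg_tgt e = y].
  move=> xy cx; have xyR : (ssval x, ssval y) \in R.
    by apply: RY; [split=> //=; apply/YP/ssvalP|exact: ssvalP|exact: ssvalP].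
  exists (SeqSub xyR); rewrite inE /= ssvalP; split=> //; first exact: val_inj.
  by apply: val_inj; rewrite /= repid // ssvalP.
case cv: (col (ssval v)).
  by have [e [eT <- <-]] := ex _ _ vw cv; exists e; rewrite eT !eqxx.
have [||e [eT <- <-]] := ex w v; first by rewrite sadj.
  by have := coladj vw; rewrite cv; case: (col _).
by exists e; rewrite eT !eqxx orbT.
Qed.

Lemma qg_tree_rooted : rooted_height qg_tree_adj (SeqSub Yb0) (fun v => h (ssval v)).
Proof.
have [sadj iadj low uniqlow] := rh; split.
- by move=> v w; rewrite !qg_tree_adjE sadj.
- by move=> v; rewrite qg_tree_adjE iadj.
- move=> v vb; have [|y vy hy] := low (ssval v).
    by move=> e; apply: vb; apply: val_inj.
  have yY := Ylow (ssvalP v) vy hy.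
  by exists (SeqSub yY); rewrite ?qg_tree_adjE.
move=> v w w'; rewrite !qg_tree_adjE => vw vw' hw hw'.
by apply: val_inj; apply: uniqlow vw vw' hw hw'.
Qed.

Lemma qg_connected u v : connect
  [rel x y | [exists e, ((qg_src e == x) && (qg_tgt e == y))
                     || ((qg_src e == y) && (qg_tgt e == x))]] u v.
Proof.
have [_ _ _ conn _] := rooted_height_tree qg_tree_rooted.
have [s ps <-] := conn u v; apply/connectP; exists s => //.
apply: sub_path ps => x y /existsP[e /andP[_ exy]].
by apply/existsP; exists e.
Qed.

Lemma qg_nonempty : (0 < #|qg_vertex|)%N.
Proof. by apply/card_gt0P; exists (SeqSub Yb0). Qed.

Definition quotient_gg : finite_graph_of_groups :=
  GraphOfGroups qg_src_inj qg_tgt_inj qg_nonempty qg_connected.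

Local Notation T := (qg_tree : {set gg_edge quotient_gg}).
Local Notation Gam := (fundamental_group T).

Lemma qg_spanning_tree : spanning_tree T.
Proof.
split; first exact: (rooted_height_tree qg_tree_rooted).
move=> e e' eT e'T /= ee'.
have [c1 c2] := edge_col e; have [c1' c2'] := edge_col e'.
(* Colours separate sources from targets, so an unordered pair of ends determines the edge. *)
have ss : ssval (qg_src e) = ssval (qg_src e').
  have : qg_src e \in [set qg_src e'; qg_tgt e']%SET by rewrite -ee' !inE eqxx.
  rewrite !inE => /orP[/eqP -> //|/eqP] /(congr1 (@ssval _ _)).
  rewrite (qg_tree_tgt e'T) => e12.
  by move: c1; rewrite -[X in col X]/(ssval (qg_src e)) e12 c2'.
have tt : ssval (qg_tgt e) = ssval (qg_tgt e').
  have : qg_tgt e \in [set qg_src e'; qg_tgt e']%SET by rewrite -ee' !inE eqxx orbT.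
  rewrite !inE => /orP[/eqP|/eqP -> //] /(congr1 (@ssval _ _)).
  rewrite (qg_tree_tgt eT) => e12.
  by move: c2; rewrite e12 c1'.
apply: val_inj; rewrite (qg_tree_tgt eT) (qg_tree_tgt e'T) in tt.
by move: ss tt; rewrite /=; case: (ssval e) => ? ?; case: (ssval e') => ? ? /= -> ->.
Qed.

Definition qg_rho (v : gg_vertex quotient_gg) :
    {multiplicative vertex_group v -> G} :=
  pack_mult (@hvalM _ _ (Stab (ssval v))).

Lemma qg_hom : exists f : {multiplicative Gam -> G},
  (forall v (g : qg_vertex_group v),
     f (@vertex_elt quotient_gg T v g) = hval g) /\
  (forall e, f (@edge_elt quotient_gg T e) = qg_elt e).
Proof.
apply: (@fundamental_group_hom quotient_gg T G qg_rho qg_elt).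
  by move=> e c; rewrite /= !mulgA mulgV mul1g.
by move=> e; rewrite inE => /tr1.
Qed.

Section Development.
Local Notation vE v g := (@vertex_elt quotient_gg T v g).
Local Notation eE := (@edge_elt quotient_gg T).
Variable f : {multiplicative Gam -> G}.
Hypotheses (fv : forall v (g : qg_vertex_group v), f (vE v g) = hval g)
  (fe : forall e : qg_edge, f (eE e) = qg_elt e).

(** The developing map, well defined because [f] maps each vertex group to the stabilizer of its
    vertex. *)
Lemma qg_develop : exists F : bs_vertex T -> V,
  forall v g, F (@bs_coset quotient_gg T v g) = act (f g) (ssval v).
Proof.
have ex x : exists z, forall v g, x = @bs_coset quotient_gg T v g ->
    z = act (f g) (ssval v).
  have [v [g ->]] := bs_vertexP x; exists (act (f g) (ssval v)) => w k e.
  have vw := bs_coset_vertex e; move: vw k e => <- k /bs_coset_eqP[l ->].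
  by rewrite multM actM fv (hvalP l).
by have [F FE] := choice ex; exists F => v g; apply: FE.
Qed.

Variable F : bs_vertex T -> V.
Hypothesis FE : forall v g, F (@bs_coset quotient_gg T v g) = act (f g) (ssval v).

Lemma develop_act g x : F (bs_act g x) = act (f g) (F x).
Proof.
by have [v [k ->]] := bs_vertexP x; rewrite bs_act_coset !FE multM actM.
Qed.

Lemma develop_src e g :
  F (@bs_coset quotient_gg T (qg_src e) g) = act (f g) (ssval e).1.
Proof. exact: FE. Qed.

Lemma develop_tgt e g :
  F (@bs_coset quotient_gg T (qg_tgt e) (g * eE e)) = act (f g) (ssval e).2.
Proof. by rewrite FE multM fe actM qg_eltE. Qed.

Lemma develop_adj x y : bs_adj x y -> adj (F x) (F y).
Proof.
have [sadj _ _ _] := rh.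
apply: (@bs_adjP _ T x y (fun x y => adj (F x) (F y))).
  by move=> a b; rewrite sadj.
move=> e g; rewrite develop_src develop_tgt act_adj; exact: edge_adj.
Qed.

(** The colour of [F x] tells which end of the edge is [x], so two edges at [x] can be compared end
    by end. *)
Lemma bs_adj_col x y : bs_adj x y -> exists e g,
  let s := @bs_coset quotient_gg T (qg_src e) g in
  let t := @bs_coset quotient_gg T (qg_tgt e) (g * eE e) in
  if col (F x) then x = s /\ y = t else x = t /\ y = s.
Proof.
move=> /asboolP[e [g xy]]; exists e, g => /=; move: xy => /=.
have [c1 c2] := edge_col e.
case=> -[-> ->]; first by rewrite develop_src colact c1.
by rewrite develop_tgt colact c2.
Qed.

Lemma fixes_edge_elt e (k : G) : act k (ssval e).1 = (ssval e).1 ->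
  act k (ssval e).2 = (ssval e).2 ->
  exists c : qg_edge_group e, [/\ hval c = k, hval (qg_src_mono e c) = k
    & hval (qg_tgt_mono e c) = (qg_elt e)^-1 * k * qg_elt e].
Proof. by move=> k1 k2; exists (hsub (edge_stab_subgroup e) (conj k1 k2)). Qed.

Lemma develop_locally_inj x y y' :
  bs_adj x y -> bs_adj x y' -> F y = F y' -> y = y'.
Proof.
move=> /bs_adj_col[e [g /= xy]] /bs_adj_col[e' [g' /= xy']] Fyy'.
have actq : act2 act (f g) (ssval e) = act2 act (f g') (ssval e').
  case: (col (F x)) xy xy' => -[xE yE] [xE' yE'];
    rewrite /act2 -!develop_src -!develop_tgt.
    by rewrite -xE -xE' -yE -yE' Fyy'.
  by rewrite -xE -xE' -yE -yE' Fyy'.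
have ee' : e = e'.
  apply: val_inj; apply: (Rorb (ssvalP e) (ssvalP e') (g := (f g')^-1 * f g)).
  by rewrite act2M // actq -act2M // mulVg act2_1.
rewrite -{e'}ee' in xy' actq; have [q1 q2] := (congr1 fst actq, congr1 snd actq).
rewrite /= in q1 q2.
(* The two edges at [x] are translates of the same [e], and the images of the translating elements
   differ by an element of its edge group. *)
have [k1 k2] : act ((f g)^-1 * f g') (ssval e).1 = (ssval e).1 /\
    act ((f g)^-1 * f g') (ssval e).2 = (ssval e).2.
  by rewrite !actM -q1 -q2 !(gactK act1 actM).
have [c [_ csrc ctgt]] := fixes_edge_elt k1 k2.
have erel := @edge_eltP quotient_gg T e c.
case: (col (F x)) xy xy' => -[xE ->] [xE' ->].
  move: xE'; rewrite xE => /(@bs_coset_eqP quotient_gg T)[k gk].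
  apply/(@bs_coset_eqP quotient_gg T); exists (qg_tgt_mono e c).
  (* [f] is injective on the vertex group, so [k] is the image of [c] there. *)
  have -> : g' = g * vE _ (qg_src_mono e c).
    rewrite gk; congr (_ * vE _ _); apply: hval_inj; rewrite csrc gk multM mulKg.
    by rewrite -fv.
  by rewrite -mulgA erel mulgA.
move: xE'; rewrite xE => /(@bs_coset_eqP quotient_gg T)[k gk].
apply/(@bs_coset_eqP quotient_gg T); exists (qg_src_mono e c).
apply: (mulIg (eE e)); rewrite gk -!mulgA erel; congr (_ * (_ * vE _ _)).
apply: hval_inj; rewrite ctgt -fv -[in RHS]fe -!multV -!multM.
have -> : g' = g * eE e * vE _ k * (eE e)^-1 by rewrite -gk mulgK.
by apply: (congr1 f); rewrite -!mulgA mulVg mulg1 !mulKg.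
Qed.

Lemma develop_inj : injective F.
Proof.
apply: (@locally_injective_tree _ V (@bs_adj quotient_gg T) adj) => //.
- exact: bs_adj_sym.
- exact/bs_reach/qg_spanning_tree.
- exact: develop_adj.
- exact: develop_locally_inj.
Qed.

(** Since [F] is injective and equivariant, a kernel element fixes the base vertex, so it lies in a
    vertex group, where [f] is the inclusion. *)
Lemma qg_hom_inj : injective f.
Proof.
suff ker g : f g = 1 -> g = 1.
  move=> g k gk; apply: (mulIg k^-1); rewrite mulgV; apply: ker.
  by rewrite multM multV gk mulgV.
move=> fg; pose v : gg_vertex quotient_gg := SeqSub Yb0.
have : bs_coset v g = bs_coset v 1 by apply: develop_inj; rewrite !FE fg mult1.
move=> /esym/bs_coset_eqP[k]; rewrite mul1g => gk.
rewrite gk -(vertex_elt1 T v); congr vertex_elt; apply: hval_inj.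
by rewrite -fv -gk fg.
Qed.

(** Paths in [P] lift edge by edge. The two cases are the colours of the current vertex, which is
    the source or the target of the edge to lift. *)
Lemma develop_surj p : P p -> exists x, F x = p.
Proof.
move=> /Pconn; apply: (@reach_ind_set _ (adj_within adj P) (fun p => exists x, F x = p)).
  move=> _ b [x <-] /and3P[xb /asboolP Px /asboolP Pb].
  have [v [g xE]] := bs_vertexP x; rewrite xE FE in xb Px.
  pose b' := act (f g)^-1 b.
  have Eb : b = act (f g) b' by rewrite /b' (gactKV act1 actM).
  have vb : adj (ssval v) b' by rewrite Eb act_adj in xb.
  have Pb' : P b' by apply/Pact.
  have Pv : P (ssval v) := YP (ssvalP v).
  case cv: (col (ssval v)).
    have [k [r [rR kr]]] : exists g r, r \in R /\ act2 act g r = (ssval v, b').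
      by apply: Rcov; split.
    pose e : qg_edge := SeqSub rR.
    have [k1 k2] := (congr1 fst kr, congr1 snd kr); rewrite /= in k1 k2.
    (* Both vertices are in [Y] and in one orbit, so they agree and [k] lies in the vertex group. *)
    have ev : qg_src e = v.
      by apply: val_inj; apply: (Yorb _ _ k1); [exact: (RP rR).2|exact: ssvalP].
    have kst : stabilizer act (ssval v) k by rewrite /stabilizer /= -{1}ev.
    exists (@bs_coset quotient_gg T (qg_tgt e)
      (g * vE v (hsub (Stab (ssval v)) kst) * eE e)).
    by rewrite develop_tgt multM actM fv /= k2 -Eb.
  have [k [r [rR kr]]] : exists g r, r \in R /\ act2 act g r = (b', ssval v).
    have [sadj _ _ _] := rh; apply: Rcov; split=> //=; first by rewrite sadj.
    by have := coladj vb; rewrite cv; case: (col b').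
  pose e : qg_edge := SeqSub rR.
  have [k1 k2] := (congr1 fst kr, congr1 snd kr); rewrite /= in k1 k2.
  have k2' : act (k * qg_elt e) (ssval (qg_tgt e)) = ssval v.
    by rewrite actM qg_eltE.
  have ev : qg_tgt e = v.
    by apply: val_inj; apply: (Yorb _ _ k2'); exact: ssvalP.
  have kst : stabilizer act (ssval v) (k * qg_elt e).
    by rewrite /stabilizer /= -{1}ev.
  exists (@bs_coset quotient_gg T (qg_src e)
    (g * vE v (hsub (Stab (ssval v)) kst) * (eE e)^-1)).
  by rewrite develop_src !multM multV fe fv /= mulgA mulgK actM k1 -Eb.
exists (@bs_coset quotient_gg T (SeqSub Yb0) 1).
by rewrite FE mult1 act1.
Qed.

(** Lift the vertex [act g b0] to a coset of some [k]; then [g] differs from [f k] by an element of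
    the stabilizer of [b0]. *)
Lemma qg_hom_surj g : exists a, f a = g.
Proof.
have [x Fx] : exists x, F x = act g b0 by apply/develop_surj/Pact/YP.
have [v [k xE]] := bs_vertexP x; rewrite xE FE in Fx.
have gv : act ((f k)^-1 * g) b0 = ssval v by rewrite actM -Fx (gactK act1 actM).
have vb : b0 = ssval v by apply: (Yorb _ _ gv); last exact: ssvalP.
have st : stabilizer act (ssval v) ((f k)^-1 * g).
  by rewrite /stabilizer /= -{1}vb.
exists (k * vE v (hsub (Stab (ssval v)) st)).
by rewrite multM fv /= mulVKg.
Qed.

End Development.

(** The cosets of the edge group in the stabilizer of one end are told apart by the images of the
    other end, which are neighbours of the first. *)
Lemma qg_finite_index e :
  finite_index (range (qg_src_mono e)) /\ finite_index (range (qg_tgt_mono e)).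
Proof.
have [sadj _ _ _] := rh.
split.
  apply: (@finite_factor _ _ _ _ (fun k : qg_vertex_group (qg_src e) =>
    act (hval k) (ssval e).2)).
    apply: (sub_finite_set _ (fadj (ssval e).1)) => _ [k _ <-] /=.
    have /= k1 := hvalP k; rewrite /stabilizer /= in k1.
    by rewrite -{1}k1 act_adj edge_adj.
  move=> k l _ _ kl; apply/(left_coset_eqP (mult_range_subgroup _)).
  exists (k^-1 * l); last by rewrite mulVKg.
  have k2 : act (hval (k^-1 * l)) (ssval e).2 = (ssval e).2.
    by rewrite hvalM actM -kl -actM mulVg act1.
  have [c [_ csrc _]] := fixes_edge_elt (hvalP (k^-1 * l)) k2.
  by exists c => //; apply: hval_inj.
(* The target group fixes a vertex of [Y]; conjugation by [t] carries it to the stabilizer of the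
   actual end of [e]. *)
pose t := qg_elt e.
have conj_fix q : act q (ssval (qg_tgt e)) = ssval (qg_tgt e) ->
    act (t * q * t^-1) (ssval e).2 = (ssval e).2.
  by move=> qe; rewrite !actM qg_eltVE qe qg_eltE.
apply: (@finite_factor _ _ _ _ (fun k : qg_vertex_group (qg_tgt e) =>
  act (t * hval k * t^-1) (ssval e).1)).
  apply: (sub_finite_set _ (fadj (ssval e).2)) => _ [k _ <-] /=.
  by rewrite -{1}(conj_fix _ (hvalP k)) act_adj sadj edge_adj.
move=> k l _ _ kl; apply/(left_coset_eqP (mult_range_subgroup _)).
exists (k^-1 * l); last by rewrite mulVKg.
pose m := t * hval (k^-1 * l) * t^-1.
have m2 : act m (ssval e).2 = (ssval e).2 := conj_fix _ (hvalP (k^-1 * l)).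
have m1 : act m (ssval e).1 = (ssval e).1.
  have -> : m = (t * hval k * t^-1)^-1 * (t * hval l * t^-1).
    by rewrite /m hvalM !invgM invgK !mulgA mulgVK.
  by rewrite actM -kl (gactK act1 actM).
have [c [_ _ ctgt]] := fixes_edge_elt m1 m2.
by exists c => //; apply: hval_inj; rewrite ctgt /m !mulgA mulVg mul1g mulgVK.
Qed.

Hypotheses (faith : faithful_action act) (nofix : ~ fixed_pair adj act).

Lemma quotient_graph_of_groups :
  exists (A : finite_graph_of_groups) (T : {set gg_edge A})
         (phi : {multiplicative G -> fundamental_group T}),
    [/\ spanning_tree T, bijective phi,
        ~ has_global_fixed_point (@bs_adj A T) (fun g : G => bs_act (phi g)),
        (forall v : gg_vertex A, residually_finite (vertex_group v))
      & (forall e : gg_edge A,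
           finite_index (range (src_mono e)) /\
           finite_index (range (tgt_mono e)))].
Proof.
have [f [fv fe]] := qg_hom; have [F FE] := qg_develop fv.
have finj := qg_hom_inj fv fe FE.
have [phi0 fphi] := choice (qg_hom_surj fv fe FE).
have phiM : {morph phi0 : g k / g * k}.
  by move=> g k; apply: finj; rewrite multM !fphi.
exists quotient_gg, T, (pack_mult phiM); split.
- exact: qg_spanning_tree.
- by exists f => [g|a] /=; [apply: fphi|apply: finj; rewrite fphi].
- rewrite global_fixed_pairP; first last.
  + by move=> g k x; rewrite multM bs_actM.
  + by move=> x; rewrite mult1 bs_act1.
  move=> [x [y [xy fixxy]]]; apply: nofix; exists (F x), (F y); split.
    by case: xy => [->|/(develop_adj fe FE)]; [left|right].
  move=> g.
  have FgE z : F (bs_act (phi0 g) z) = act g (F z) by rewrite (develop_act FE) fphi.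
  by case: (fixxy g) => -[gx gy]; [left|right]; rewrite -!FgE gx gy.
- move=> v; exact: (stabilizer_residually_finite act_adj tadj fadj faith).
exact: qg_finite_index.
Qed.

End QuotientGraphOfGroups.

Lemma bipartite_graph_of_groups (G : groupType) (V : choiceType) (adj : rel V)
    (act : G -> V -> V) (col : V -> bool) :
  finitely_generated G -> is_tree adj -> locally_finite adj ->
  is_simplicial_action adj act -> faithful_action act -> ~ fixed_pair adj act ->
  (forall g x, col (act g x) = col x) ->
  (forall x y, adj x y -> col x = ~~ col y) ->
  exists (A : finite_graph_of_groups) (T : {set gg_edge A})
         (phi : {multiplicative G -> fundamental_group T}),
    [/\ spanning_tree T, bijective phi,
        ~ has_global_fixed_point (@bs_adj A T) (fun g : G => bs_act (phi g)),
        (forall v : gg_vertex A, residually_finite (vertex_group v))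
      & (forall e : gg_edge A,
           finite_index (range (src_mono e)) /\
           finite_index (range (tgt_mono e)))].
Proof.
move=> Gfg tadj fadj [act1 actM act_adj] faith nofix colact coladj.
have [[b0] _ _ _ _] := tadj.
have [h [rh h0 hdiff]] := is_tree_height b0 tadj.
have [n Pconn] := orbit_ball_connected act1 actM act_adj rh hdiff Gfg.
have [Y0 [[YP Ylow Yorb] Yb0 Yfin Ycov]] :=
  exists_transversal_tree act1 actM act_adj fadj rh h0 hdiff Pconn.
have [R0 [/finite_seqP[R RE] RP Rcov Rorb RY]] :=
  exists_edge_representatives act1 actM act_adj fadj b0 colact Yorb Yfin Ycov.
have /finite_seqP[Y YE] := Yfin.
rewrite {}YE in YP Ylow Yorb Yb0 Ycov RP RY; rewrite {}RE in RP Rcov Rorb RY.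
pose P := orbit_ball act h n.
(* The representative in [Y] and the element carrying it to [p] are chosen together, with the
   element trivial on [Y]. *)
have ext p : exists q : V * G, P p ->
    [/\ q.1 \in Y, act q.2 q.1 = p & p \in Y -> q.2 = 1].
  have [Yp|nYp] := boolP (p \in Y); first by exists (p, 1); split.
  have [/Ycov[g Ygp]|nP] := pselect (P p); last by exists (p, 1) => /nP.
  exists (act g p, g^-1) => _; split=> //; first exact: (gactK act1 actM).
have [q qP] := choice ext.
apply: (@quotient_graph_of_groups G V adj act act1 actM act_adj fadj tadj
  b0 h col P Y R (fst \o q) (snd \o q)) => //.
- by move=> g x; apply: orbit_ball_act.
- by move=> p /qP[].
- by move=> p /qP[].
- by move=> y yY; have [_ _] := qP y (YP y yY); apply.
Qed.

Theorem theorem2p2 (G : groupType) (Gfg : finitely_generated G) :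
  (exists (V : choiceType) (adj : rel V) (act : G -> V -> V),
     [/\ is_tree adj,
         locally_finite adj,
         is_simplicial_action adj act,
         faithful_action act
       & ~ has_global_fixed_point adj act])
  <->
  (exists (A : finite_graph_of_groups) (T : {set gg_edge A})
          (phi : {multiplicative G -> fundamental_group T}),
     [/\ spanning_tree T,
         bijective phi,
         ~ has_global_fixed_point (@bs_adj A T) (fun g : G => bs_act (phi g)),
         (forall v : gg_vertex A, residually_finite (vertex_group v))
       & (forall e : gg_edge A,
            finite_index (range (src_mono e)) /\
            finite_index (range (tgt_mono e)))]).
Proof.
split=> [[V [adj [act [tadj fadj [act1 actM act_adj] faith nofix]]]]|].
  apply: (@bipartite_graph_of_groups G _ (@subdivision_adj V adj)
    (subdivision_act act_adj) (@is_original V adj)) => //.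
  - exact: subdivision_tree.
  - exact: subdivision_locally_finite.
  - split; [exact: subdivision_act1|exact: subdivision_actM|].
    exact: subdivision_act_adj.
  - exact: subdivision_faithful.
  - move=> /subdivision_fixed_pair fp; apply: nofix.
    exact/global_fixed_pairP.
  - exact: subdivision_original_act.
  - exact: subdivision_original_adj.
move=> [A [T [phi [sT phi_bij nofix rf fin_edge]]]].
exact: (graph_of_groups_faithful_action fin_edge sT phi_bij).
Qed.
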